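(* Let $X_1,X_2$ be uniformly nonsquare Banach spaces and let $\|\cdot\|_\psi$ be any absolute normalized norm on $\mathbb{R}^2$. Then the direct sum $X_1\oplus_\psi X_2$ has the fixed point property.
   Context: A Banach space $X$ is uniformly nonsquare if $\sup_{x,y\in S_X}\min\{\|x+y\|,\|x-y\|\}<2$. A norm on $\mathbb{R}^2$ is absolute if $\|(x_1,x_2)\|=\|(|x_1|,|x_2|)\|$ and normalized if $\|(1,0)\|=\|(0,1)\|=1$ (equivalently, monotone and normalized). $X_1\oplus_\psi X_2$ is $X_1\times X_2$ with norm $\|(x_1,x_2)\|_\psi=\|(\|x_1\|,\|x_2\|)\|_\psi$. Fixed point property: every nonexpansive mapping $T:C\to C$ on a nonempty bounded closed convex subset $C$ has a fixed point. *)

(* Defs.v *)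
From HB Require Import structures.
From mathcomp Require Import all_boot all_order all_algebra.
From mathcomp Require Import all_classical all_reals all_analysis.
Set Implicit Arguments. Unset Strict Implicit. Unset Printing Implicit Defensive.
Import Order.TTheory GRing.Theory Num.Theory.
Import numFieldNormedType.Exports.
Local Open Scope ring_scope.

Definition uniformly_nonsquare (R : realType) (X : normedModType R) : Prop :=
  exists d : R, d < 2 /\
    forall x y : X, `|x| = 1 -> `|y| = 1 -> Num.min `|x + y| `|x - y| <= d.

Definition is_norm_R2 (R : realType) (psi : R -> R -> R) : Prop :=
  (forall a b, psi a b = 0 -> a = 0 /\ b = 0) /\
  (forall t a b, psi (t * a) (t * b) = `|t| * psi a b) /\
  (forall a b c d, psi (a + c) (b + d) <= psi a b + psi c d).

Definition absolute_normalized_norm (R : realType) (psi : R -> R -> R) : Prop :=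
  is_norm_R2 psi /\
  (forall a b, psi a b = psi `|a| `|b|) /\
  psi 1 0 = 1 /\ psi 0 1 = 1.

Definition psi_sum_norm (R : realType) (X1 X2 : normedModType R)
  (psi : R -> R -> R) (z : X1 * X2) : R := psi `|z.1| `|z.2|.

Definition N_convex (R : realType) (V : lmodType R) (C : set V) : Prop :=
  forall x y t, C x -> C y -> 0 <= t <= 1 -> C (t *: x + (1 - t) *: y).

Definition N_bounded (R : realType) (V : lmodType R) (N : V -> R) (C : set V) : Prop :=
  exists M : R, forall x, C x -> N x <= M.

Definition N_closed (R : realType) (V : lmodType R) (N : V -> R) (C : set V) : Prop :=
  forall x, (forall e : R, 0 < e -> exists y, C y /\ N (x - y) < e) -> C x.

Definition N_nonexpansive_on (R : realType) (V : lmodType R) (N : V -> R)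
  (C : set V) (T : V -> V) : Prop :=
  forall x y, C x -> C y -> N (T x - T y) <= N (x - y).

Definition fixed_point_property (R : realType) (V : lmodType R) (N : V -> R) : Prop :=
  forall (C : set V), (exists x, C x) -> N_bounded N C -> N_closed N C -> N_convex C ->
  forall T : V -> V, (forall x, C x -> C (T x)) -> N_nonexpansive_on N C T ->
  exists x, C x /\ T x = x.

(* Main.v *)
Require Import Defs.
From mathcomp Require Import all_boot all_order all_algebra.
From mathcomp Require Import all_classical all_reals all_analysis.
From mathcomp Require Import ring lra.
Set Implicit Arguments. Unset Strict Implicit. Unset Printing Implicit Defensive.
Import Order.TTheory GRing.Theory Num.Theory.
Import numFieldNormedType.Exports.
Local Open Scope ring_scope.

(** Compactness. Let x be a bounded family in a uniformly nonsquare space and U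
    an ultrafilter. If x had no weak limit along U, then the iterated norms
    of a_1 x_{i_1} + ... + a_n x_{i_n}, i_1 << i_2 << ..., would be bounded
    below on the lists (a_j) some tail of which has sum 1 or -1. Following
    James, weave two copies of a list whose tail sums alternate n + 1 times
    between 1 and -1: their half sum alternates n + 1 times and their half
    difference n times, so nonsquareness makes the least norm of such lists
    grow geometrically in n, whereas explicit lists have norms linear in n.

    Fixed points. Take a minimal invariant convex body K of diameter c > 0, an
    approximate fixed point sequence x_n with weak limit o, and 0 < t < 1. By
    Goebel-Karlovitz and Lin there are w_n in K, with weak limit w, such that
    lim |w_n - x_n| <= (1 - t) c, lim lim |w_n - w_m| <= t c and |w_n - o| is
    almost c. With p, q, v in R^2 the coordinatewise values of |w - o|, of
    lim lim |w_n - w_m| and of lim |w_n - o|, nonsquareness of X_i gives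
    v_i <= p_i + q_i - kappa min(p_i, q_i), while psi p <= (1 - t) c,
    psi q <= t c and psi v = c. Convexity of psi then forces v = p + q, hence
    p_i q_i = 0 for i = 1, 2, and finally that one coordinate of
    lim |x_n - o| equals t c. This cannot hold for three values of t. *)

(** * Subgradients *)

Section Subgradient.
Variables (R : realType) (V : lmodType R).

Definition convex_fun (g : V -> R) : Prop :=
  forall x y t, 0 <= t <= 1 -> g (t *: x + (1 - t) *: y) <= t * g x + (1 - t) * g y.

Definition sublinear (q : V -> R) : Prop :=
  (forall u v, q (u + v) <= q u + q v) /\ (forall t u, 0 < t -> q (t *: u) <= t * q u).

Definition linear_fun (f : V -> R) : Prop :=
  forall a u v, f (a *: u + v) = a * f u + f v.

Lemma sublinear0 q : sublinear q -> q 0 = 0.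
Proof.
move=> [_ qZ]; have := qZ 2 0; have := qZ 2^-1 0.
rewrite !scaler0 => /(_ ltac:(lra)) h1 /(_ ltac:(lra)) h2; lra.
Qed.

Lemma sublinearZ q t u : sublinear q -> 0 < t -> q (t *: u) = t * q u.
Proof.
move=> [_ qZ] t0; apply/eqP; rewrite eq_le qZ//=.
have ti0 : 0 < t^-1 by rewrite invr_gt0.
have := qZ t^-1 (t *: u) ti0; rewrite scalerA mulVf ?gt_eqF// scale1r.
by rewrite -(ler_pM2l t0) mulrA divff ?gt_eqF// mul1r.
Qed.

Lemma sublinear_convex q : sublinear q -> convex_fun q.
Proof.
move=> sq x y t /andP[t0 t1].
apply: (le_trans (sq.1 _ _)).
have h s v : 0 <= s -> q (s *: v) = s * q v.
  rewrite le_eqVlt => /orP[/eqP<-|]; last exact: sublinearZ.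
  by rewrite scale0r mul0r sublinear0.
by rewrite !h// subr_ge0.
Qed.

Section directional_derivative.
Variables (g : V -> R) (w : V).
Hypothesis gconv : convex_fun g.

Definition slopes (u : V) : set R :=
  [set r | exists2 t, 0 < t & r = (g (w + t *: u) - g w) / t].

(** For convex [g] the slopes increase with the step, so this infimum is the one-sided directional
    derivative of [g] at [w]. *)
Definition dir_deriv (u : V) : R := inf (slopes u).

(** [w] is the combination of [w + t *: u] and [w - u] with weights 1 / (1 + t) and t / (1 + t), so
    no slope is below the backward difference. *)
Lemma slopes_lbound u : has_lbound (slopes u).
Proof.
exists (g w - g (w - u)) => _ [t t0 ->].
have t1 : 0 < 1 + t by lra.
have := gconv (w + t *: u) (w - u) (t := (1 + t)^-1).
have -> : (1 + t)^-1 *: (w + t *: u) + (1 - (1 + t)^-1) *: (w - u) = w.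
  have -> : 1 - (1 + t)^-1 = t / (1 + t) by field; rewrite gt_eqF.
  rewrite !scalerDr !scalerN !scalerA [in X in X *: u]mulrC addrACA subrr addr0.
  by rewrite -scalerDl -[X in (X + _) *: _]mul1r -mulrDl divff ?gt_eqF// scale1r.
rewrite invr_ge0 ltW//= invf_le1// => /(_ ltac:(lra)) h.
rewrite ler_pdivlMr//.
have : (1 + t) * g w <= g (w + t *: u) + t * g (w - u).
  have := ler_wpM2l (ltW t1) h; rewrite mulrDr !mulrA mulrBr mulr1 divff ?gt_eqF//.
  by rewrite mul1r addrAC subrr add0r.
nra.
Qed.

Lemma slopes_neq0 u : (slopes u !=set0)%classic.
Proof. by exists ((g (w + 1 *: u) - g w) / 1), 1. Qed.

Lemma dir_deriv_le u t : 0 < t -> dir_deriv u <= (g (w + t *: u) - g w) / t.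
Proof. by move=> t0; apply: ge_inf; [exact: slopes_lbound|exists t]. Qed.

Lemma dir_deriv_lt u e : 0 < e ->
  exists2 t, 0 < t & (g (w + t *: u) - g w) / t < dir_deriv u + e.
Proof.
move=> e0; have [|_ [t t0 ->]] := @inf_adherent _ (slopes u) e e0.
  by split; [exact: slopes_neq0|exact: slopes_lbound].
by exists t.
Qed.

Lemma dir_deriv_sublinear : sublinear dir_deriv.
Proof.
split=> [u v|t u t0].
  apply/ler_addgt0Pr => e e0.
  have e2 : 0 < e / 2 by lra.
  have [t t0 ht] := dir_deriv_lt u e2; have [s s0 hs] := dir_deriv_lt v e2.
  have ts0 : 0 < t + s by lra.
  apply: (@le_trans _ _ ((g (w + t *: u) - g w) / t + (g (w + s *: v) - g w) / s));
    last by lra.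
  (* With this step length the point in direction [u + v] is a convex combination of [w + t *: u]
     and [w + s *: v], and its slope is at most the sum of theirs. *)
  apply: (le_trans (dir_deriv_le (t := t * s / (t + s)) _ _)).
    by rewrite divr_gt0// mulr_gt0.
  have := gconv (w + t *: u) (w + s *: v) (t := s / (t + s)).
  have -> : 1 - s / (t + s) = t / (t + s) by field; rewrite gt_eqF.
  have -> : s / (t + s) *: (w + t *: u) + t / (t + s) *: (w + s *: v) =
     w + (t * s / (t + s)) *: (u + v).
    rewrite !scalerDr !scalerA addrACA -scalerDl.
    have -> : s / (t + s) + t / (t + s) = 1 by field; rewrite gt_eqF.
    rewrite scale1r; congr (_ + (_ *: _ + _ *: _)); field; by rewrite gt_eqF.
  have st01 : 0 <= s / (t + s) <= 1.
    by apply/andP; split; [rewrite divr_ge0 ?ltW|rewrite ler_pdivrMr//; lra].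
  move=> /(_ st01) h.
  rewrite ler_pdivrMr; last by rewrite divr_gt0// mulr_gt0.
  apply: (@le_trans _ _ (s / (t + s) * g (w + t *: u) + t / (t + s) * g (w + s *: v) - g w)).
    by rewrite lerD2r.
  rewrite le_eqVlt; apply/orP; left; apply/eqP; field.
  by rewrite !gt_eqF.
apply/ler_addgt0Pr => e e0.
have et0 : 0 < e / t by rewrite divr_gt0.
have [s s0 hs] := dir_deriv_lt u et0.
apply: (le_trans (dir_deriv_le (t := s / t) _ _)); first by rewrite divr_gt0.
rewrite scalerA divfK ?gt_eqF//.
have -> : t * dir_deriv u + e = t * (dir_deriv u + e / t) by field; rewrite gt_eqF.
have -> : (g (w + s *: u) - g w) / (s / t) = t * ((g (w + s *: u) - g w) / s).
  by field; rewrite !gt_eqF.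
by rewrite ler_pM2l// ltW.
Qed.

End directional_derivative.

(* If q is minimal among the sublinear functions below p, then q is its own
   directional derivative at every v, so q (- v) <= - q v. *)
Lemma hahn_banach (p : V -> R) : sublinear p ->
  exists2 f, linear_fun f & forall u, f u <= p u.
Proof.
move=> sp.
pose T := {q : V -> R | sublinear q /\ forall u, q u <= p u}.
(* Greater for [r] means smaller pointwise, so Zorn's maximal element is a minimal sublinear
   function. *)
pose r (q q' : T) := `[< forall u, sval q' u <= sval q u >].
have [| | | |[q [sq qp]] qmin] := @Zorn T r.
- by move=> q; apply/asboolP.
- move=> q1 q2 q3 /asboolP h1 /asboolP h2; apply/asboolP => u.
  exact: le_trans (h2 u) (h1 u).
- move=> [q1 h1] [q2 h2] /asboolP /= h12 /asboolP /= h21.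
  apply: eq_exist => /=; apply/funext => u; apply/eqP; rewrite eq_le h12 ?h21//.
- move=> A totA.
  have [A0|/forallNP A0] := pselect (exists q, A q); last first.
    by exists (exist _ p (conj sp (fun u => lexx _))) => q /A0.
  have [q0 Aq0] := A0.
  pose E u := [set sval q u | q in A]%classic.
  have Elb u : has_lbound (E u).
    exists (- p (- u)) => _ [q _ <-]; have [[qD qZ] qp] := svalP q.
    have := qD u (- u); rewrite subrr (sublinear0 (conj qD qZ)).
    have := qp (- u); lra.
  have E0 u : (E u !=set0)%classic by exists (sval q0 u), q0.
  (* The pointwise infimum bounds the chain; it is finite because sublinearity gives - p (- u) <= q
     u for every member [q]. *)
  pose m u := inf (E u).
  have mle u q : A q -> m u <= sval q u by move=> Aq; apply: ge_inf => //; exists q.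
  have mlt u e : 0 < e -> exists2 q, A q & sval q u < m u + e.
    by move=> e0; have [|_ [q Aq <-] h] := @inf_adherent _ (E u) e e0 => //; exists q.
  have sm : sublinear m.
    split=> [u v|t u t0].
      apply/ler_addgt0Pr => e e0.
      have e2 : 0 < e / 2 by lra.
      have [q1 A1 h1] := mlt u _ e2; have [q2 A2 h2] := mlt v _ e2.
      have [q [Aq hq1 hq2]] : exists q, [/\ A q, sval q u <= sval q1 u & sval q v <= sval q2 v].
        have [/asboolP h|/asboolP h] := totA _ _ A1 A2.
          by exists q2; split.
        by exists q1; split.
      have := (svalP q).1.1 u v; have := mle (u + v) q Aq; lra.
    apply/ler_addgt0Pr => e e0.
    have et0 : 0 < e / t by rewrite divr_gt0.
    have [q Aq h] := mlt u _ et0.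
    apply: (le_trans (mle _ q Aq)); apply: (le_trans ((svalP q).1.2 _ _ t0)).
    have -> : t * m u + e = t * (m u + e / t) by field; rewrite gt_eqF.
    by rewrite ler_pM2l// ltW.
  have mp u : m u <= p u by apply: (le_trans (mle u q0 Aq0)); exact: (svalP q0).2.
  by exists (exist _ m (conj sm mp)) => q Aq; apply/asboolP => u; exact: mle.
have qconv := sublinear_convex sq.
have qN v : q (- v) = - q v.
  pose q' := dir_deriv q v.
  have q'q u : q' u <= q u.
    apply: (le_trans (dir_deriv_le v qconv u (t := 1) ltr01)).
    by rewrite scale1r divr1 lerBlDl sq.1.
  have q'p u : q' u <= p u := le_trans (q'q u) (qp u).
  have := qmin (exist _ q' (conj (dir_deriv_sublinear v qconv) q'p)).
  move=> /(_ ltac:(exact/asboolP)) [q'E].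
  have := dir_deriv_le v qconv (- v) (t := 1) ltr01.
  rewrite -/q' q'E scale1r divr1 subrr sublinear0// add0r => h.
  by have := sq.1 v (- v); rewrite subrr sublinear0//; lra.
exists q => // a u v.
have qD x y : q (x + y) = q x + q y.
  apply/eqP; rewrite eq_le sq.1/=.
  by have := sq.1 (x + y) (- y); rewrite addrK qN; lra.
rewrite qD; congr (_ + _).
have [a0|a0|->] := ltgtP a 0; last by rewrite scale0r mul0r sublinear0.
  have Na0 : 0 < - a by lra.
  have := qN (- a *: u); rewrite -scaleNr opprK (sublinearZ u sq Na0) => ->; ring.
by rewrite sublinearZ.
Qed.

Lemma subgradient (g : V -> R) (w : V) : convex_fun g ->
  exists2 f, linear_fun f & forall u, f u <= g (w + u) - g w.
Proof.
move=> gconv.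
have [f lf fle] := hahn_banach (dir_deriv_sublinear w gconv).
exists f => // u; apply: (le_trans (fle u)).
by have := dir_deriv_le w gconv u ltr01; rewrite scale1r divr1.
Qed.

End Subgradient.

(** * Limits along ultrafilters *)

Section Ultralimit.
Variables (R : realType) (I : Type) (U : set_system I).
Hypothesis UU : UltraFilter U.
Local Open Scope classical_set_scope.

Let PU : ProperFilter U := ultra_proper.

Definition fbounded (J : Type) (h : J -> R) : Prop := exists M, forall i, `|h i| <= M.

(** For bounded [h] this is the limit along [U], by [ulim_near]. Being a total function, it can be a
    mere default value for unbounded [h], whence the boundedness premises below. *)
Definition ulim (h : I -> R) : R := sup [set r | U [set i | r <= h i]].

Lemma ultraT (A : set I) : (forall i, A i) -> U A.
Proof.
move=> AT; rewrite (_ : A = setT); first exact: filterT.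
by apply/seteqP; split=> // i _; exact: AT.
Qed.

Lemma ulim_eq h l : (forall e, 0 < e -> U [set i | `|h i - l| < e]) -> ulim h = l.
Proof.
move=> hl.
have memE e : 0 < e -> [set r | U [set i | r <= h i]] (l - e).
  move=> e0; apply: filterS (hl e e0) => i /=; rewrite ltr_norml => /andP[? _]; lra.
have ubE e : 0 < e -> ubound [set r | U [set i | r <= h i]] (l + e).
  move=> e0 r /= Ur.
  have [i [/= ri]] := filter_ex (filterI Ur (hl e e0)).
  rewrite ltr_norml => /andP[_ ?]; lra.
have hs : has_sup [set r | U [set i | r <= h i]].
  by split; [exists (l - 1); exact: memE|exists (l + 1); exact: ubE].
apply/eqP; rewrite eq_le; apply/andP; split; apply/ler_addgt0Pr => e e0.
  by apply: ge_sup; [exact: hs.1|exact: ubE].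
by rewrite -lerBlDr; apply: ub_le_sup; [exact: hs.2|exact: memE].
Qed.

Lemma ulim_near h e : fbounded h -> 0 < e -> U [set i | `|h i - ulim h| < e].
Proof.
move=> [M hM] e0; set E := [set r | U [set i | r <= h i]].
have hs : has_sup E.
  split; first by exists (- M); apply: ultraT => i /=; have := hM i; rewrite ler_norml => /andP[].
  exists M => r /= /filter_ex[i /= ri].
  by have := hM i; rewrite ler_norml => /andP[_]; exact: le_trans.
have h1 : U [set i | ulim h - e < h i].
  have [r Er rl] := sup_adherent e0 hs.
  by apply: filterS Er => i /= /(lt_le_trans _); apply; exact: rl.
have h2 : U [set i | h i < ulim h + e].
  (* An ultrafilter contains this set or its complement; the set itself would give a level above the
     supremum. *)
  have [h3|] := in_ultra_setVsetC [set i | ulim h + e <= h i] UU.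
    have := ub_le_sup hs.2 h3; rewrite -/(ulim h); lra.
  by apply: filterS => i /= /negP; rewrite -ltNge.
apply: filterS (filterI h1 h2) => i /= [? ?]; rewrite ltr_norml; lra.
Qed.

Lemma ulim_le h1 h2 : fbounded h1 -> fbounded h2 -> U [set i | h1 i <= h2 i] ->
  ulim h1 <= ulim h2.
Proof.
move=> b1 b2 le12; apply/ler_addgt0Pr => e e0.
have e2 : 0 < e / 2 by lra.
have [i [/= h [/=]]] := filter_ex (filterI le12 (filterI (ulim_near b1 e2) (ulim_near b2 e2))).
rewrite !ltr_norml; lra.
Qed.

Lemma ulim_cst (c : R) : ulim (fun=> c) = c.
Proof. by apply: ulim_eq => e e0; apply: ultraT => i /=; rewrite subrr normr0. Qed.

Lemma fbounded_cst (J : Type) (c : R) : fbounded (fun _ : J => c).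
Proof. by exists `|c|. Qed.

Lemma fboundedP (J : Type) a b (h : J -> R) : (forall i, a <= h i <= b) -> fbounded h.
Proof.
move=> ab; exists (`|a| + `|b|) => i.
have /andP[] := ab i; rewrite ler_norml => ? ?; apply/andP; split.
  by have := ler_norm (- a); rewrite normrN; have := normr_ge0 b; lra.
by have := ler_norm b; have := normr_ge0 a; lra.
Qed.

Lemma ulim_ge h c : fbounded h -> U [set i | c <= h i] -> c <= ulim h.
Proof. by move=> bh ch; rewrite -(ulim_cst c); apply: ulim_le => //; exact: fbounded_cst. Qed.

Lemma ulim_le_cst h c : fbounded h -> U [set i | h i <= c] -> ulim h <= c.
Proof. by move=> bh ch; rewrite -(ulim_cst c); apply: ulim_le => //; exact: fbounded_cst. Qed.

Lemma ulim_lt_near h c : fbounded h -> ulim h < c -> U [set i | h i < c].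
Proof.
move=> bh hc; have e0 : 0 < c - ulim h by lra.
by apply: filterS (ulim_near bh e0) => i /=; rewrite ltr_norml; lra.
Qed.

Lemma ulim_gt_near h c : fbounded h -> c < ulim h -> U [set i | c < h i].
Proof.
move=> bh hc; have e0 : 0 < ulim h - c by lra.
by apply: filterS (ulim_near bh e0) => i /=; rewrite ltr_norml; lra.
Qed.

(** Serves for addition, for [min] and for absolute normalized norms. *)
Lemma ulim_lip2 (F : R -> R -> R) h1 h2 :
  (forall a b a' b', `|F a b - F a' b'| <= `|a - a'| + `|b - b'|) ->
  fbounded h1 -> fbounded h2 ->
  ulim (fun i => F (h1 i) (h2 i)) = F (ulim h1) (ulim h2).
Proof.
move=> Flip b1 b2; apply: ulim_eq => e e0; have e2 : 0 < e / 2 by lra.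
apply: filterS (filterI (ulim_near b1 e2) (ulim_near b2 e2)) => i /= [? ?].
by apply: (le_lt_trans (Flip _ _ _ _)); lra.
Qed.

Lemma ulimD h1 h2 : fbounded h1 -> fbounded h2 ->
  ulim (fun i => h1 i + h2 i) = ulim h1 + ulim h2.
Proof.
apply: (@ulim_lip2 (fun a b => a + b)) => a b a' b'.
by rewrite opprD addrACA ler_normD.
Qed.

Lemma ulimZ a h : fbounded h -> ulim (fun i => a * h i) = a * ulim h.
Proof.
move=> bh; apply: ulim_eq => e e0.
have a0 : 0 < `|a| + 1 by have := normr_ge0 a; lra.
have e1 : 0 < e / (`|a| + 1) by rewrite divr_gt0.
apply: filterS (ulim_near bh e1) => i /= hi.
rewrite -mulrBr normrM.
apply: (@le_lt_trans _ _ ((`|a| + 1) * `|h i - ulim h|)).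
  by rewrite ler_wpM2r// lerDl.
by rewrite -ltr_pdivlMl// mulrC.
Qed.

End Ultralimit.

(** * Weak limits with respect to a seminorm *)

Section WeakUltralimit.
Variables (R : realType) (V : lmodType R) (N : V -> R).

Definition seminorm : Prop :=
  (forall a x, N (a *: x) = `|a| * N x) /\ (forall x y, N (x + y) <= N x + N y).

Definition dual_ball (f : V -> R) : Prop := linear_fun f /\ forall x, f x <= N x.

(** Every bounded functional is a multiple of one in the dual ball, so for bounded [x] this is weak
    convergence along [U]. *)
Definition weak_ulim (I : Type) (U : set_system I) (x : I -> V) (w : V) : Prop :=
  forall f, dual_ball f -> ulim U (f \o x) = f w.

(** The form in which reflexivity is used: weak compactness of balls, without a weak topology. *)
Definition weakly_ultracompact : Prop :=
  forall (I : Type) (U : set_system I) (x : I -> V), UltraFilter U ->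
    fbounded (N \o x) -> exists w, weak_ulim U x w.

Hypothesis sN : seminorm.

Lemma linear_funD f u v : @linear_fun R V f -> f (u + v) = f u + f v.
Proof. by move=> lf; have := lf 1 u v; rewrite scale1r mul1r. Qed.

Lemma linear_fun0 f : @linear_fun R V f -> f 0 = 0.
Proof. by move=> lf; have := lf 1 0 0; rewrite scaler0 addr0 mul1r; lra. Qed.

Lemma linear_funZ f a u : @linear_fun R V f -> f (a *: u) = a * f u.
Proof. by move=> lf; have := lf a u 0; rewrite !addr0 linear_fun0// addr0. Qed.

Lemma linear_funB f u v : @linear_fun R V f -> f (u - v) = f u - f v.
Proof. by move=> lf; have := lf (-1) v u; rewrite scaleN1r addrC => ->; ring. Qed.

Lemma seminorm0 : N 0 = 0.
Proof. by have := sN.1 0 0; rewrite scale0r normr0 mul0r. Qed.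

Lemma seminormN x : N (- x) = N x.
Proof. by rewrite -scaleN1r sN.1 normrN1 mul1r. Qed.

Lemma seminormBC x y : N (x - y) = N (y - x).
Proof. by rewrite -seminormN opprB. Qed.

Lemma seminorm_ge0 x : 0 <= N x.
Proof. by have := sN.2 x (- x); rewrite subrr seminorm0 seminormN; lra. Qed.

Lemma seminorm_tri y x z : N (x - z) <= N (x - y) + N (y - z).
Proof. by have := sN.2 (x - y) (y - z); rewrite addrA subrK. Qed.

Lemma seminormB x y : N (x - y) <= N x + N y.
Proof. by have := sN.2 x (- y); rewrite seminormN. Qed.

Lemma seminorm_lip x y : N x - N y <= N (x - y).
Proof. by have := sN.2 (x - y) y; rewrite subrK; lra. Qed.

Lemma dual_ball_abs f x : dual_ball f -> `|f x| <= N x.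
Proof.
move=> [lf fN]; rewrite ler_norml fN andbT.
by have := fN (- x); rewrite seminormN -[- x]scaleN1r linear_funZ//; lra.
Qed.

Lemma dual_ballN f : dual_ball f -> dual_ball (fun x => - f x).
Proof.
move=> df; split=> [a u v|x]; first by rewrite df.1; ring.
by have := dual_ball_abs x df; rewrite ler_norml; lra.
Qed.

Lemma fbounded_dual (I : Type) (x : I -> V) f : dual_ball f ->
  fbounded (N \o x) -> fbounded (f \o x).
Proof.
move=> df [M hM]; exists M => i; apply: (le_trans (dual_ball_abs _ df)).
exact: le_trans (ler_norm _) (hM i).
Qed.

Lemma fbounded_seminormB (I : Type) (x y : I -> V) :
  fbounded (N \o x) -> fbounded (N \o y) -> fbounded (fun i => N (x i - y i)).
Proof.
move=> [M hM] [M' hM']; exists (M + M') => i; rewrite ger0_norm ?seminorm_ge0//.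
apply: (le_trans (seminormB _ _)); apply: lerD.
  exact: le_trans (ler_norm _) (hM i).
exact: le_trans (ler_norm _) (hM' i).
Qed.

Definition nonexpansive_fun (g : V -> R) : Prop := forall u v, g u - g v <= N (u - v).

Lemma nonexpansive_seminorm y : nonexpansive_fun (fun z => N (z - y)).
Proof.
move=> u v; apply: (le_trans (seminorm_lip _ _)).
by rewrite opprB addrA subrK.
Qed.

Lemma convex_seminorm y : convex_fun (fun z => N (z - y)).
Proof.
move=> u v t /andP[t0 t1].
have -> : t *: u + (1 - t) *: v - y = t *: (u - y) + (1 - t) *: (v - y).
  by rewrite !scalerBr addrACA -opprD -scalerDl addrCA subrr addr0 scale1r.
by apply: (le_trans (sN.2 _ _)); rewrite !sN.1 !ger0_norm// subr_ge0.
Qed.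

Section WeakLimits.
Variables (I : Type) (U : set_system I).
Hypothesis UU : UltraFilter U.

Let PU : ProperFilter U := ultra_proper.

Lemma fbounded_nonexpansive (x : I -> V) g : nonexpansive_fun g ->
  fbounded (N \o x) -> fbounded (g \o x).
Proof.
move=> gN [M hM]; apply: (@fboundedP _ _ (g 0 - M) (g 0 + M)) => i /=.
have hx : N (x i) <= M := le_trans (ler_norm _) (hM i).
by have := gN (x i) 0; have := gN 0 (x i); rewrite sub0r seminormN subr0; lra.
Qed.

(** Weak lower semicontinuity: a subgradient of [g] at [w] lies in the dual ball because [g] is
    nonexpansive, and the affine minorant that it defines passes to the limit. *)
Lemma weak_ulim_convex (x : I -> V) w g : fbounded (N \o x) -> weak_ulim U x w ->
  convex_fun g -> nonexpansive_fun g -> g w <= ulim U (g \o x).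
Proof.
move=> bx xw cg gN; have [f lf fg] := subgradient w cg.
have df : dual_ball f.
  by split=> // u; apply: (le_trans (fg u)); have := gN (w + u) w; rewrite addrAC subrr add0r.
have bg := fbounded_nonexpansive gN bx.
have : ulim U (fun i => f (x i) + (g w - f w)) <= ulim U (g \o x).
  have bf := fbounded_dual df bx.
  apply: ulim_le => //.
    have [M hM] := bf; exists (M + `|g w - f w|) => i.
    by apply: (le_trans (ler_normD _ _)); rewrite lerD2r; exact: hM.
  apply: ultraT => i /=; have := fg (x i - w).
  by rewrite [w + _]addrC subrK linear_funB//; lra.
rewrite (ulimD UU (h1 := f \o x) (h2 := fun=> g w - f w)); last 2 first.
- exact: fbounded_dual bx.
- exact: fbounded_cst.
by rewrite xw// ulim_cst addrC subrK.
Qed.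

Lemma weak_ulim_seminorm (x : I -> V) w : fbounded (N \o x) -> weak_ulim U x w ->
  N w <= ulim U (N \o x).
Proof.
move=> bx xw.
have := weak_ulim_convex bx xw (convex_seminorm 0) (nonexpansive_seminorm 0).
by rewrite /comp subr0; under eq_fun do rewrite subr0.
Qed.

Lemma weak_ulimB (x y : I -> V) u v : fbounded (N \o x) -> fbounded (N \o y) ->
  weak_ulim U x u -> weak_ulim U y v -> weak_ulim U (fun i => x i - y i) (u - v).
Proof.
move=> bx b_y xu yv f df.
rewrite (_ : f \o _ = fun i => (f \o x) i + -1 * (f \o y) i); last first.
  by apply/funext => i /=; rewrite (linear_funB _ _ df.1); ring.
have bfy := fbounded_dual df b_y.
rewrite ulimD//; last 2 first.
- exact: fbounded_dual bx.
- by have [M hM] := bfy; exists M => i; rewrite mulN1r normrN.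
by rewrite ulimZ// xu// yv// (linear_funB _ _ df.1); ring.
Qed.

Lemma fbounded_comb a b (h h' : I -> R) : fbounded h -> fbounded h' ->
  fbounded (fun i => a * h i + b * h' i).
Proof.
move=> [M hM] [M' hM']; exists (`|a| * M + `|b| * M') => i.
apply: (le_trans (ler_normD _ _)); rewrite !normrM.
by apply: lerD; rewrite ler_wpM2l.
Qed.

Lemma ulim_comb a b (h h' : I -> R) : fbounded h -> fbounded h' ->
  ulim U (fun i => a * h i + b * h' i) = a * ulim U h + b * ulim U h'.
Proof.
move=> bh bh'.
have b1 : fbounded (fun n => a * h n).
  by have := fbounded_comb a 0 bh bh'; under eq_fun do rewrite mul0r addr0.
have b2 : fbounded (fun n => b * h' n).
  by have := fbounded_comb 0 b bh bh'; under eq_fun do rewrite mul0r add0r.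
by rewrite ulimD// !ulimZ.
Qed.

Lemma ulim_convex (h : I -> V -> R) : (forall y, fbounded (h^~ y)) ->
  (forall i, convex_fun (h i)) -> convex_fun (fun y => ulim U (h^~ y)).
Proof.
move=> bh ch y z t t01; rewrite -ulim_comb//.
apply: ulim_le => //; first exact: fbounded_comb.
by apply: ultraT => i /=; exact: ch.
Qed.

Lemma ulim_nonexpansive (h : I -> V -> R) : (forall y, fbounded (h^~ y)) ->
  (forall i, nonexpansive_fun (h i)) -> nonexpansive_fun (fun y => ulim U (h^~ y)).
Proof.
move=> bh nh y z.
have -> : ulim U (h^~ y) - ulim U (h^~ z) = ulim U (fun i => 1 * h i y + -1 * h i z).
  by rewrite ulim_comb// mul1r mulN1r.
apply: ulim_le_cst => //; first exact: fbounded_comb.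
by apply: ultraT => i /=; rewrite mul1r mulN1r; exact: nh.
Qed.

End WeakLimits.
End WeakUltralimit.

(** * James' theorem *)

Section NonSquare.
Variables (R : realType) (X : normedModType R).

(** With upper bounds in place of unit norms, nonsquareness survives limits in which lengths are
    controlled only from above. *)
Definition nonsquare_by (theta : R) : Prop := forall (x y : X) m, `|x| <= m -> `|y| <= m ->
  `|2^-1 *: (x + y)| <= theta * m \/ `|2^-1 *: (x - y)| <= theta * m.

Lemma norm_seminorm : seminorm (fun x : X => `|x|).
Proof. by split=> [a x|x y]; [rewrite normrZ|exact: ler_normD]. Qed.

Lemma norm_normalize_dist (x : X) m : `|x| <= m -> x != 0 ->
  `|m *: (`|x|^-1 *: x) - x| = m - `|x|.
Proof.
move=> xm x0; have nx0 : `|x| != 0 by rewrite normr_eq0.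
rewrite scalerA -[X in _ - X]scale1r -scalerBl normrZ.
have -> : m / `|x| - 1 = (m - `|x|) / `|x| by field.
by rewrite normrM normfV normr_id ger0_norm ?subr_ge0// divfK.
Qed.

(** If half sum and half difference are both nearly [m] long, so are [x] and [y]; replacing them by
    [m] times unit vectors then costs at most (m - |x|) + (m - |y|), too little to escape the bound
    on the sphere. *)
Lemma uniformly_nonsquareP : uniformly_nonsquare X ->
  exists2 theta, 0 < theta < 1 & nonsquare_by theta.
Proof.
(* A trivial space has no unit vectors and admits any [d0]; the maximum keeps theta above 1/2, which
   is what excludes x = 0 and y = 0 below. *)
move=> [d0 [d02 hd0]]; pose d := Num.max d0 1.
have d1 : 1 <= d by rewrite le_max lexx orbT.
have d2 : d < 2 by rewrite gt_max d02 ltr1n.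
have hd (x y : X) : `|x| = 1 -> `|y| = 1 -> `|x + y| <= d \/ `|x - y| <= d.
  move=> x1 y1; have := hd0 x y x1 y1; rewrite ge_min => /orP[h|h]; [left|right];
  by rewrite (le_trans h)// le_max lexx.
(* The estimate yields a contradiction as soon as theta >= (2 + d) / 4; as d < 2, this value lies
   above that and below 1. *)
exists ((4 + d) / 6); first by lra.
move=> x y m xm ym; set th := (4 + d) / 6.
have thE : 6 * th = 4 + d by rewrite /th; lra.
have [|h1] := leP `|2^-1 *: (x + y)| (th * m); first by left.
have [|h2] := leP `|2^-1 *: (x - y)| (th * m); first by right.
exfalso; move: h1 h2; rewrite !normrZ ger0_norm; last by lra.
move=> h1 h2.
have m0 : 0 <= m := le_trans (normr_ge0 x) xm.
have t1 := ler_normD x y.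
have mgt0 : 0 < m by rewrite lt_neqAle m0 andbT; apply/eqP => m00; subst m; nra.
have x0 : x != 0.
  by apply/eqP => x0; move: t1 h1; rewrite x0 normr0 add0r; nra.
have y0 : y != 0.
  by apply/eqP => y0; move: t1 h1; rewrite y0 normr0 addr0; nra.
pose x' := `|x|^-1 *: x; pose y' := `|y|^-1 *: y.
have ux : `|x'| = 1 by rewrite normrZ normfV normr_id mulVf ?normr_eq0.
have uy : `|y'| = 1 by rewrite normrZ normfV normr_id mulVf ?normr_eq0.
have key (s : X) (s' : X) : `|m *: s' - s| <= (m - `|x|) + (m - `|y|) ->
    `|s'| <= d -> `|s| <= m * d + (m - `|x|) + (m - `|y|).
  move=> hs hs'; have := ler_normB (m *: s') (m *: s' - s).
  rewrite opprB addrC subrK normrZ (ger0_norm m0) => h.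
  have : m * `|s'| <= m * d by rewrite ler_wpM2l.
  lra.
have dx := norm_normalize_dist xm x0; have dy := norm_normalize_dist ym y0.
have [h|h] := hd x' y' ux uy.
  have hs : `|m *: (x' + y') - (x + y)| <= (m - `|x|) + (m - `|y|).
    rewrite scalerDr opprD addrACA.
    by apply: (le_trans (ler_normD _ _)); rewrite dx dy.
  have := key _ _ hs h; nra.
have hs : `|m *: (x' - y') - (x - y)| <= (m - `|x|) + (m - `|y|).
  rewrite scalerBr opprD opprK addrACA [- _ + y]addrC -[y - _]opprB.
  by apply: (le_trans (ler_normB _ _)); rewrite dx dy.
have := key _ _ hs h; nra.
Qed.

Lemma nonsquare_byW theta theta' : nonsquare_by theta -> theta <= theta' -> nonsquare_by theta'.
Proof.
move=> ns tt x y m xm ym; have m0 : 0 <= m := le_trans (normr_ge0 x) xm.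
have mt : theta * m <= theta' * m by rewrite ler_wpM2r.
by have [h|h] := ns x y m xm ym; [left|right]; apply: le_trans mt.
Qed.

End NonSquare.

(** * Iterated norms and alternating lists *)

Section IteratedNorm.
Variables (R : realType) (X : normedModType R) (I : Type) (U : set_system I).
Hypothesis UU : UltraFilter U.
Variables (x : I -> X) (M : R).
Hypothesis xM : forall i, `|x i| <= M.
Local Open Scope classical_set_scope.

Let PU : ProperFilter U := ultra_proper.

(* The norm of v + a_1 x_{i_1} + ... + a_n x_{i_n} for i_1 << i_2 << ... along U. *)
Fixpoint iter_norm (l : seq R) (v : X) : R :=
  if l is a :: l' then ulim U (fun i => iter_norm l' (v + a *: x i)) else `|v|.

Definition abs_sum (l : seq R) : R := \sum_(a <- l) `|a|.

Lemma iter_norm_bounds l v : 0 <= iter_norm l v <= `|v| + M * abs_sum l.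
Proof.
elim: l v => [|a l IH] v; first by rewrite /abs_sum big_nil mulr0 addr0 normr_ge0 lexx.
have h i : 0 <= iter_norm l (v + a *: x i) <= `|v| + M * abs_sum (a :: l).
  have /andP[-> /= h] := IH (v + a *: x i); apply: (le_trans h).
  rewrite /abs_sum big_cons mulrDr addrA lerD2r.
  apply: (le_trans (ler_normD _ _)); rewrite lerD2l normrZ mulrC.
  by rewrite ler_wpM2r.
have bh := fboundedP h; apply/andP; split.
  by apply: ulim_ge => //; apply: ultraT => i /=; have /andP[] := h i.
by apply: ulim_le_cst => //; apply: ultraT => i /=; have /andP[] := h i.
Qed.

Lemma fbounded_iter_norm l a v : fbounded (fun i => iter_norm l (v + a *: x i)).
Proof.
apply: (@fboundedP _ _ 0 (`|v| + `|a| * M + M * abs_sum l)) => i.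
have /andP[-> /= h] := iter_norm_bounds l (v + a *: x i); apply: (le_trans h).
rewrite lerD2r; apply: (le_trans (ler_normD _ _)); rewrite lerD2l normrZ.
by rewrite ler_wpM2l.
Qed.

Lemma iter_norm_cat l l1 l2 v : (forall v, iter_norm l1 v = iter_norm l2 v) ->
  iter_norm (l ++ l1) v = iter_norm (l ++ l2) v.
Proof.
move=> l12; elim: l v => //= a l IH v.
by congr ulim; apply/funext => i; exact: IH.
Qed.

Lemma iter_norm_nseq0 k l v : iter_norm (nseq k 0 ++ l) v = iter_norm l v.
Proof.
elim: k v => //= k IH v; rewrite -[RHS](ulim_cst UU); congr ulim.
by apply/funext => i; rewrite scale0r addr0.
Qed.

Lemma iter_norm_ge_cat c l1 l2 v : (forall v, c <= iter_norm l2 v) ->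
  c <= iter_norm (l1 ++ l2) v.
Proof.
move=> cl2; elim: l1 v => //= a l IH v; apply: ulim_ge => //.
  exact: fbounded_iter_norm.
by apply: ultraT => i /=.
Qed.

Definition half_sums (L : seq (R * R)) : seq R := [seq (p.1 + p.2) / 2 | p <- L].
Definition half_diffs (L : seq (R * R)) : seq R := [seq (p.1 - p.2) / 2 | p <- L].

(** One index realises all four limits up to e / 2. The induction hypothesis there, with bound m + e
    / 2, contradicts a failure by [e] because theta < 1. *)
Lemma iter_norm_nonsquare theta : 0 < theta < 1 -> nonsquare_by X theta ->
  forall L v w m, iter_norm (unzip1 L) v <= m -> iter_norm (unzip2 L) w <= m ->
  iter_norm (half_sums L) (2^-1 *: (v + w)) <= theta * m \/
  iter_norm (half_diffs L) (2^-1 *: (v - w)) <= theta * m.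
Proof.
move=> /andP[t0 t1] ns; elim=> [|[a b] L IH] v w m /=; first exact: ns.
move=> h1 h2.
set A := (X in X <= _ \/ _); set B := (X in _ \/ X <= _).
have [|hA] := leP A (theta * m); first by left.
have [|hB] := leP B (theta * m); first by right.
exfalso; pose e := Num.min (A - theta * m) (B - theta * m).
have eA : e <= A - theta * m by rewrite ge_min lexx.
have eB : e <= B - theta * m by rewrite ge_min lexx orbT.
have e0 : 0 < e by rewrite lt_min !subr_gt0 hA.
have h1' : ulim U (fun i => iter_norm (unzip1 L) (v + a *: x i)) < m + e / 2 by lra.
have h2' : ulim U (fun i => iter_norm (unzip2 L) (w + b *: x i)) < m + e / 2 by lra.
have hA' : A - e / 2 < A by lra.
have hB' : B - e / 2 < B by lra.
have := filter_ex (filterI (filterI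
  (ulim_lt_near UU (fbounded_iter_norm _ _ _) h1')
  (ulim_lt_near UU (fbounded_iter_norm _ _ _) h2'))
  (filterI (ulim_gt_near UU (fbounded_iter_norm _ _ _) hA')
          (ulim_gt_near UU (fbounded_iter_norm _ _ _) hB'))).
move=> [i /= [[h1i h2i] [hAi hBi]]].
have := IH _ _ _ (ltW h1i) (ltW h2i).
have -> : 2^-1 *: (v + a *: x i + (w + b *: x i)) =
    2^-1 *: (v + w) + ((a + b) / 2) *: x i.
  by rewrite addrACA -scalerDl scalerDr scalerA [_ * (a + b)]mulrC.
have -> : 2^-1 *: (v + a *: x i - (w + b *: x i)) =
    2^-1 *: (v - w) + ((a - b) / 2) *: x i.
  by rewrite opprD addrACA -scalerBl scalerDr scalerA [_ * (a - b)]mulrC.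
by move=> [h|h]; nra.
Qed.

(** Consequently a list of sum 1 (of sum -1) whose iterated norm at [v] is small makes [- v] (makes
    [v]) represent the limit functional up to a small error on the whole dual ball. *)
Lemma iter_norm_dual l v f : dual_ball (fun x : X => `|x|) f ->
  f v + (\sum_(a <- l) a) * ulim U (f \o x) <= iter_norm l v.
Proof.
move=> df; elim: l v => [|a l IH] v /=.
  by rewrite big_nil mul0r addr0; exact: df.2.
rewrite big_cons.
have bf : fbounded (f \o x).
  apply: fbounded_dual df _; first exact: norm_seminorm.
  by exists M => i; rewrite /= normr_id.
have baf : fbounded (fun i => a * (f \o x) i).
  by have [K hK] := bf; exists (`|a| * K) => i; rewrite normrM ler_wpM2l// hK.
set c := _ * ulim U _.
have -> : f v + c = ulim U (fun i => f v + (a * (f \o x) i + (\sum_(b <- l) b) * ulim U (f \o x))).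
  rewrite (ulimD UU (h1 := fun=> f v)); last 2 first.
  - exact: fbounded_cst.
  - have [K hK] := baf; exists (K + `|\sum_(b <- l) b * ulim U (f \o x)|) => i.
    by apply: (le_trans (ler_normD _ _)); rewrite -mulr_suml lerD2r hK.
  rewrite (ulimD UU baf (fbounded_cst _ _)) !ulim_cst//.
  by rewrite ulimZ// /c mulrDl.
apply: ulim_le => //.
- have [K hK] := baf.
  exists (`|f v| + (K + `|\sum_(b <- l) b * ulim U (f \o x)|)) => i.
  apply: (le_trans (ler_normD _ _)); rewrite lerD2l.
  by apply: (le_trans (ler_normD _ _)); rewrite -mulr_suml lerD2r hK.
- exact: fbounded_iter_norm.
apply: ultraT => i /=; apply: le_trans (IH _).
by rewrite (linear_funD _ _ df.1) (linear_funZ _ _ df.1) addrA.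
Qed.

(* l can be cut at n places so that the sums of the corresponding tails are
   s, - s, s, ... from left to right. *)
Fixpoint alternates (n : nat) (s : R) (l : seq R) : Prop :=
  if n is n'.+1 then exists l0 l1, [/\ l = l0 ++ l1, \sum_(a <- l1) a = s & alternates n' (- s) l1]
  else True.

Lemma alternates_cat n s l0 l : alternates n s l -> alternates n s (l0 ++ l).
Proof.
case: n => //= n [l1 [l2 [-> s2 a2]]].
by exists (l0 ++ l1), l2; rewrite catA.
Qed.

Lemma alternatesW n s l : alternates n.+1 s l -> alternates n s l.
Proof.
elim: n s l => // n IH s l [l0 [l1 [-> s1 a1]]].
by exists l0, l1; split => //; exact: IH.
Qed.

(** The two copies of [l] occupy disjoint indices. The zeros do not affect iterated norms, while in
    the half differences the second copy changes sign. *)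
Definition weave (l : seq R) (L : seq (R * R)) : seq (R * R) :=
  [seq (a, 0) | a <- l] ++ ([seq (0, a) | a <- l] ++ L).

Lemma unzip1_weave l L : unzip1 (weave l L) = l ++ (nseq (size l) 0 ++ unzip1 L).
Proof.
rewrite /unzip1 /weave !map_cat -!map_comp; congr (_ ++ (_ ++ _)).
  by elim: l => //= a l ->.
by elim: l => //= a l ->.
Qed.

Lemma unzip2_weave l L : unzip2 (weave l L) = nseq (size l) 0 ++ (l ++ unzip2 L).
Proof.
rewrite /unzip2 /weave !map_cat -!map_comp; congr (_ ++ (_ ++ _)).
  by elim: l => //= a l ->.
by elim: l => //= a l ->.
Qed.

Lemma iter_norm_weave1 l l' L v : (forall v, iter_norm (unzip1 L) v = iter_norm l' v) ->
  iter_norm (unzip1 (weave l L)) v = iter_norm (l ++ l') v.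
Proof.
move=> h; rewrite unzip1_weave; apply: iter_norm_cat => u.
by rewrite iter_norm_nseq0.
Qed.

Lemma iter_norm_weave2 l l' L v : (forall v, iter_norm (unzip2 L) v = iter_norm l' v) ->
  iter_norm (unzip2 (weave l L)) v = iter_norm (l ++ l') v.
Proof.
by move=> h; rewrite unzip2_weave iter_norm_nseq0; apply: iter_norm_cat.
Qed.

(** In the half sums the next cut stays in front of the inner [L]. In the half differences that tail
    sums to 0, but a cut between the two copies of [l0], whose sum is 2 s, leaves - s. *)
Lemma weave_tail n s l : \sum_(a <- l) a = s -> alternates n (- s) l ->
  exists L, [/\ (forall v, iter_norm (unzip1 L) v = iter_norm l v) /\
       (forall v, iter_norm (unzip2 L) v = iter_norm l v),
     \sum_(a <- unzip1 L) a = s /\ \sum_(a <- unzip2 L) a = s,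
     alternates n (- s) (half_sums L) & alternates n (- s) (half_diffs L)].
Proof.
elim: n s l => [|n IH] s l ls.
  move=> _; exists [seq (a, a) | a <- l].
  have h1 : unzip1 [seq (a, a) | a <- l] = l by elim: l {ls} => //= a l ->.
  have h2 : unzip2 [seq (a, a) | a <- l] = l by elim: l {ls h1} => //= a l ->.
  by split; rewrite ?h1 ?h2.
move=> [l0 [l1 [lE sl1]]]; rewrite opprK => al1.
have [L [[n1 n2] [s1 s2]]] := IH (- s) l1 sl1 ltac:(by rewrite opprK).
rewrite opprK => hs hd.
have sl0 : \sum_(a <- l0) a = 2 * s.
  by move: ls; rewrite lE big_cat /= sl1; lra.
have sumS : \sum_(a <- half_sums L) a = - s.
  rewrite big_map -mulr_suml big_split /=.
  by move: s1 s2; rewrite !big_map => -> ->; lra.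
have sumD : \sum_(a <- half_diffs L) a = 0.
  rewrite big_map -mulr_suml big_split /= sumrN.
  by move: s1 s2; rewrite !big_map => -> ->; lra.
exists (weave l0 L); split.
- rewrite lE; split=> v; [exact: iter_norm_weave1|exact: iter_norm_weave2].
- rewrite unzip1_weave unzip2_weave !big_cat /= s1 s2 sl0 big_nseq.
  by rewrite iter_addr_0 mul0rn; lra.
- rewrite /half_sums /weave !map_cat -/(half_sums L) catA.
  by eexists _, (half_sums L); split; [reflexivity| |rewrite opprK].
- rewrite /half_diffs /weave !map_cat -/(half_diffs L).
  eexists _, (_ ++ half_diffs L); split; [reflexivity| |].
    rewrite big_cat /= sumD addr0 !big_map /= -mulr_suml.
    under eq_bigr do rewrite sub0r.
    by rewrite sumrN sl0; lra.
  by rewrite opprK; exact: alternates_cat.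
Qed.

(** The prefix [l0] before the outermost cut has an arbitrary sum, so no cut between its copies can
    be controlled: the half differences lose one alternation, the half sums none. *)
Lemma weave_alternates n s l : alternates n.+1 s l ->
  exists L, [/\ (forall v, iter_norm (unzip1 L) v = iter_norm l v),
     (forall v, iter_norm (unzip2 L) v = iter_norm l v),
     alternates n.+1 s (half_sums L) & alternates n (- s) (half_diffs L)].
Proof.
move=> [l0 [l1 [lE sl1 al1]]].
have [L [[n1 n2] [s1 s2] hs hd]] := weave_tail sl1 al1.
exists (weave l0 L); split.
- by rewrite lE => v; exact: iter_norm_weave1.
- by rewrite lE => v; exact: iter_norm_weave2.
- rewrite /half_sums /weave !map_cat -/(half_sums L) catA.
  eexists _, (half_sums L); split; [reflexivity| |by []].
  rewrite big_map -mulr_suml big_split /=.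
  by move: s1 s2; rewrite !big_map => -> ->; lra.
- rewrite /half_diffs /weave !map_cat -/(half_diffs L) catA.
  exact: alternates_cat.
Qed.

(** The list 2 s, - 2 s, 2 s, ... closed by a single s or - s: all its nonempty tails sum to s or -
    s, while the sum of absolute values is linear in [n]. *)
Fixpoint zigzag (n : nat) (s : R) : seq R :=
  if n is n'.+1 then 2 * s :: zigzag n' (- s) else [:: s].

Lemma sum_zigzag n s : \sum_(a <- zigzag n s) a = s.
Proof.
elim: n s => [|n IH] s /=; first by rewrite big_seq1.
by rewrite big_cons IH; lra.
Qed.

Lemma alternates_zigzag n s : alternates n.+1 s (zigzag n s).
Proof.
elim: n s => [|n IH] s; first by exists [::], [:: s]; rewrite big_seq1.
exists [::], (zigzag n.+1 s); split => //; first exact: sum_zigzag.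
exact: (alternates_cat [:: 2 * s] (IH (- s))).
Qed.

Lemma abs_sum_zigzag n s : abs_sum (zigzag n s) = (2 * n%:R + 1) * `|s|.
Proof.
elim: n s => [|n IH] s /=; rewrite /abs_sum ?big_seq1 ?mulr0 ?add0r ?mul1r//.
rewrite big_cons -/(abs_sum _) IH normrN normrM ger0_norm ?ler0n// -natr1; ring.
Qed.

(** Induction: after weaving, half sums and half differences both still alternate often enough, and
    one of them has iterated norm at most theta times that of [l]. *)
Lemma iter_norm_geometric theta c : 0 < theta < 1 -> nonsquare_by X theta ->
  (forall l v, \sum_(a <- l) a = 1 \/ \sum_(a <- l) a = -1 -> c <= iter_norm l v) ->
  forall n l s, s = 1 \/ s = -1 -> alternates n.+1 s l -> c <= theta ^+ n * iter_norm l 0.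
Proof.
move=> /andP[t0 t1] ns cl; elim=> [|n IH] l s s1 al.
  move: al => [l0 [l1 [-> sl1 _]]]; rewrite expr0 mul1r.
  by apply: iter_norm_ge_cat => v; apply: cl; rewrite sl1.
have [L [L1 L2 hs hd]] := weave_alternates al.
have Ns1 : - s = 1 \/ - s = - 1 by case: s1 => ->; [right|left; rewrite opprK].
have c1 := IH _ _ s1 (alternatesW hs).
have c2 := IH _ _ Ns1 hd.
have t01 : 0 < theta < 1 by rewrite t0.
have := iter_norm_nonsquare t01 ns (L := L) (v := 0) (w := 0) (m := iter_norm l 0).
rewrite L1 L2 addr0 subr0 scaler0 exprS => /(_ (lexx _) (lexx _)) h.
have tn : 0 < theta ^+ n by rewrite exprn_gt0.
by case: h => h; nra.
Qed.

(** Otherwise zigzags would give c <= theta^n M (2 n + 1) for all [n]. *)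
Lemma iter_norm_degenerate theta c : 0 < theta < 1 -> nonsquare_by X theta -> 0 < c ->
  exists l v, (\sum_(a <- l) a = 1 \/ \sum_(a <- l) a = -1) /\ iter_norm l v < c.
Proof.
move=> t01 ns c0; apply: contrapT => /forallNP hn.
have cl l v : \sum_(a <- l) a = 1 \/ \sum_(a <- l) a = -1 -> c <= iter_norm l v.
  by move=> sl; rewrite leNgt; apply/negP => h; apply: (hn l); exists v.
have main n : c <= theta ^+ n * (M * (2 * n%:R + 1)).
  have := iter_norm_geometric t01 ns cl (or_introl erefl) (alternates_zigzag n 1).
  move=> /le_trans; apply; have /andP[/ltW t0 _] := t01.
  rewrite ler_wpM2l ?exprn_ge0//.
  have /andP[_] := iter_norm_bounds (zigzag n 1) 0.
  by rewrite normr0 add0r abs_sum_zigzag normr1 mulr1.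
have /andP[t0 t1] := t01.
pose h := theta^-1 - 1.
have h0 : 0 < h by rewrite subr_gt0 invf_gt1.
have bern n : 1 + n%:R * h <= theta^-1 ^+ n.
  elim: n => [|n IH]; first by rewrite expr0 mul0r addr0.
  have -> : theta^-1 = 1 + h by rewrite /h; lra.
  rewrite exprS; have hn0 : 0 <= n%:R :> R by rewrite ler0n.
  have IH' : 1 + n%:R * h <= (1 + h) ^+ n by rewrite (_ : 1 + h = theta^-1)// /h; lra.
  rewrite -natr1; nra.
(* Bernoulli's bound is only linear in [n]; at the exponent 2 n it can be squared, and quadratic
   growth beats the linear right-hand side. *)
have sq n : c * (1 + n%:R * h) ^+ 2 <= M * (4 * n%:R + 1).
  have := main (n * 2)%N; rewrite natrM => hm.
  have tn : 0 < theta ^+ (n * 2) by rewrite exprn_gt0.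
  have : c * theta^-1 ^+ (n * 2) <= M * (4 * n%:R + 1).
    rewrite exprVn -ler_pdivlMr ?invr_gt0// invrK mulrC.
    by apply: (le_trans hm); rewrite (_ : 2 * (n%:R * 2) = 4 * n%:R)//; ring.
  apply: le_trans; rewrite ler_pM2l// exprM; apply: lerXn2r; rewrite ?nnegrE.
  - by rewrite addr_ge0// mulr_ge0// ltW.
  - by rewrite exprn_ge0// invr_ge0 ltW.
  - exact: bern.
have M0 : 0 <= M.
  by have := sq 0; rewrite mul0r !mulr0 addr0 add0r expr1n !mulr1 => /(le_trans (ltW c0)).
have ch0 : 0 < c * h ^+ 2 by rewrite mulr_gt0// exprn_gt0.
(* For k = n + 1 >= 1 the right-hand side M (4 k + 1) is at most 5 M k, so it suffices that k c h^2
   exceeds 5 M. *)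
pose n := Num.bound (5 * M / (c * h ^+ 2)).
have hb : 5 * M < n.+1%:R * (c * h ^+ 2).
  have : 5 * M / (c * h ^+ 2) < n%:R.
    by apply: archi_boundP; rewrite divr_ge0 ?mulr_ge0// ltW.
  by rewrite ltr_pdivrMr// -natr1; nra.
have := sq n.+1; have n1 : 1 <= n.+1%:R :> R by rewrite ler1n.
set k := n.+1%:R in hb n1 * => hk.
have : c * (k * h) ^+ 2 <= c * (1 + k * h) ^+ 2 by rewrite ler_pM2l//; nra.
rewrite exprMn; nra.
Qed.

End IteratedNorm.

(** * Weak compactness in uniformly nonsquare spaces *)

Section James.
Variables (R : realType) (X : normedModType R).
Local Open Scope classical_set_scope.

(** A subgradient of the norm at [v]; tested at [- v] it yields f v >= |v|. *)
Lemma norming_functional (v : X) :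
  exists2 f, dual_ball (fun x : X => `|x|) f & f v = `|v|.
Proof.
have cg : @convex_fun R X (fun x : X => `|x|).
  have := convex_seminorm (norm_seminorm X) 0.
  by under eq_fun do rewrite subr0.
have [f lf fle] := subgradient v cg.
have df : dual_ball (fun x : X => `|x|) f.
  split=> // u; apply: (le_trans (fle u)); have := ler_normD v u; lra.
exists f => //; apply/eqP; rewrite eq_le df.2/=.
have := fle (- v); rewrite subrr normr0 -[- v]scaleN1r (linear_funZ _ _ lf); lra.
Qed.

(** The limit functional [F] is within every e > 0 of some vector, uniformly on the dual ball. As
    norms are attained there, approximations with errors 1 / (n + 1) form a Cauchy sequence, and its
    limit represents [F]. *)
Lemma nonsquare_weakly_ultracompact :
  (forall F : set_system X, ProperFilter F -> cauchy F -> cvg F) ->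
  uniformly_nonsquare X -> weakly_ultracompact (fun x : X => `|x|).
Proof.
move=> Xcomplete /uniformly_nonsquareP[theta t01 ns] I U x UU [M xM].
pose F (f : X -> R) := ulim U (f \o x).
have xM' i : `|x i| <= M by have := xM i; rewrite /= normr_id.
have approx e : 0 < e -> exists z, forall f, dual_ball (fun x : X => `|x|) f -> `|F f - f z| <= e.
  move=> e0; apply: contrapT => /forallNP hn.
  have bad z : exists2 f, dual_ball (fun x : X => `|x|) f & e < F f - f z.
    have /existsNP[f /not_implyP[df /negP]] := hn z.
    rewrite -ltNge lter_normr => /orP[h|h]; first by exists f.
    exists (fun x => - f x); first exact (dual_ballN (norm_seminorm X) df).
    suff -> : F (fun x => - f x) = - F f by lra.
    rewrite /F (_ : _ \o x = fun i => -1 * (f \o x) i); last by apply/funext => i; rewrite mulN1r.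
    by rewrite ulimZ ?mulN1r//; apply: fbounded_dual df _; [exact: norm_seminorm|exists M].
  have [l [v [sl]]] := iter_norm_degenerate UU xM' t01 ns e0.
  apply/negP; rewrite -leNgt.
  case: sl => sl.
    have [f df h] := bad (- v); have := iter_norm_dual UU xM' l v df.
    rewrite sl mul1r; move: h; rewrite -[- v]scaleN1r (linear_funZ _ _ df.1) /F; lra.
  have [f df h] := bad v.
  have dNf := dual_ballN (norm_seminorm X) df.
  have := iter_norm_dual UU xM' l v dNf; rewrite sl.
  suff -> : ulim U ((fun x => - f x) \o x) = - F f by lra.
  rewrite (_ : _ \o x = fun i => -1 * (f \o x) i); last by apply/funext => i; rewrite /= mulN1r.
  by rewrite ulimZ ?mulN1r//; apply: fbounded_dual df _; [exact: norm_seminorm|exists M].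
have approx_nat n : exists z, forall f, dual_ball (fun x : X => `|x|) f ->
    `|F f - f z| <= n.+1%:R^-1.
  by apply: approx; rewrite invr_gt0.
have [z hz] := choice approx_nat.
have zd n m : `|z n - z m| <= n.+1%:R^-1 + m.+1%:R^-1.
  have [f df <-] := norming_functional (z n - z m).
  rewrite (linear_funB _ _ df.1); move: (hz n f df) (hz m f df).
  set rn := n.+1%:R^-1; set rm := m.+1%:R^-1.
  rewrite !ler_norml => /andP[? ?] /andP[? ?]; lra.
have zc : cvgn z.
  apply: Xcomplete; apply/cauchyP => /= e e0.
  have e2 : 0 < e / 2 by lra.
  have hinv := near_infty_natSinv_lt (PosNum e2).
  have [k /= ke] := filter_ex hinv.
  exists (z k); apply: filterS hinv => n /= ne.
  rewrite -ball_normE /=; apply: (le_lt_trans (zd _ _)).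
  by apply: (lt_le_trans (ltrD ke ne)) => /=; lra.
exists (limn z) => f df.
apply/eqP; rewrite -subr_eq0 -normr_eq0 eq_le normr_ge0 andbT.
apply/ler_addgt0Pr => e e0; rewrite add0r.
have e2 : 0 < e / 2 by lra.
have /cvgrPdist_lt /(_ _ e2) h1 := zc.
have h2 := near_infty_natSinv_lt (PosNum e2).
have [n [/= zn ne]] := filter_ex (filterI h1 h2).
have := le_trans (hz n f df) (ltW ne).
have := dual_ball_abs (norm_seminorm X) (limn z - z n) df.
rewrite (linear_funB _ _ df.1) -/(F f) /= => h3 h4.
have := ler_normD (F f - f (z n)) (f (z n) - f (limn z)).
rewrite addrA subrK [`|f (z n) - _|]distrC; lra.
Qed.

End James.

(** * Minimal invariant sets *)

Section MinimalInvariantSets.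
Variables (R : realType) (V : lmodType R) (N : V -> R).
Hypotheses (sN : seminorm N) (cN : weakly_ultracompact N).
Local Open Scope classical_set_scope.

(** Mazur's theorem: the distance to [C] is convex, nonexpansive and zero along [x], hence zero at
    [w]. *)
Lemma closed_convex_weak_ulim (I : Type) (U : set_system I) (x : I -> V) (C : set V) w :
  UltraFilter U -> N_closed N C -> N_convex C -> fbounded (N \o x) ->
  weak_ulim N U x w -> (forall i, C (x i)) -> C w.
Proof.
move=> UU Ccl Ccv bx xw Cx; have PU := @ultra_proper _ _ UU.
have [i0 _] := filter_ex (@filterT _ U _).
pose E z := [set N (z - y) | y in C].
have Elb z : has_lbound (E z) by exists 0 => _ [y _ <-]; exact: seminorm_ge0.
have E0 z : E z !=set0 by exists (N (z - x i0)), (x i0).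
pose g z := inf (E z).
have gle z y : C y -> g z <= N (z - y) by move=> Cy; apply: ge_inf => //; exists y.
have glt z e : 0 < e -> exists2 y, C y & N (z - y) < g z + e.
  by move=> e0; have [|_ [y Cy <-] h] := @inf_adherent _ (E z) e e0 => //; exists y.
have g0 z : 0 <= g z by apply: lb_le_inf => // _ [y _ <-]; exact: seminorm_ge0.
have gconv : convex_fun g.
  move=> u v t t01; apply/ler_addgt0Pr => e e0.
  have [y Cy hy] := glt u e e0; have [z Cz hz] := glt v e e0.
  apply: (le_trans (gle _ _ (Ccv _ _ _ Cy Cz t01))).
  rewrite opprD addrACA -!scalerBr; apply: (le_trans (sN.2 _ _)).
  have /andP[t0 t1] := t01.
  rewrite !sN.1 !ger0_norm ?subr_ge0//; nra.
have gne : nonexpansive_fun N g.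
  move=> u v; rewrite lerBlDr; apply/ler_addgt0Pr => e e0.
  have [y Cy hy] := glt v e e0; apply: (le_trans (gle u y Cy)).
  by have := seminorm_tri sN v u y; lra.
have gx i : g (x i) = 0.
  apply/eqP; rewrite eq_le g0 andbT; have := gle (x i) (x i) (Cx i).
  by rewrite subrr seminorm0.
have := weak_ulim_convex sN UU bx xw gconv gne.
rewrite (_ : g \o x = fun=> 0); last by apply/funext => i /=.
rewrite ulim_cst => gw; apply: Ccl => e e0.
by have [y Cy hy] := glt w e e0; exists y; split=> //; lra.
Qed.

Definition invariant_body (T : V -> V) (K : set V) : Prop :=
  [/\ K !=set0, N_closed N K, N_convex K & forall x, K x -> K (T x)].

Lemma exists_minimal_invariant_body (T : V -> V) (C : set V) :
  N_bounded N C -> invariant_body T C ->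
  exists K, [/\ K `<=` C, invariant_body T K &
    forall K', invariant_body T K' -> K' `<=` K -> K `<=` K'].
Proof.
move=> [M CM] invC.
pose S := {K : set V | invariant_body T K /\ K `<=` C}.
pose r (K K' : S) := `[< sval K' `<=` sval K >].
have [| | | |[K [invK KC]] Kmin] := @Zorn S r.
- by move=> K; apply/asboolP.
- move=> K1 K2 K3 /asboolP h1 /asboolP h2; apply/asboolP.
  exact: subset_trans h2 h1.
- move=> [K1 h1] [K2 h2] /asboolP /= h12 /asboolP /= h21.
  by apply: eq_exist => /=; apply/seteqP.
- move=> A totA.
  have [[K0 AK0]|/forallNP A0] := pselect (exists K, A K); last first.
    by exists (exist _ C (conj invC (@subset_refl _ C))) => K /A0.
  (* The filter generated by the chain. Along an ultrafilter refining it, the identity, with a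
     default value outside [C], has a weak limit, which will lie in every member of the chain. *)
  pose F := [set B : set V | exists2 K, A K & sval K `<=` B].
  have FF : ProperFilter F.
    split; first by move=> [K AK Kn]; have [[[y Ky] _ _ _] _] := svalP K; exact: (Kn y).
    split; first by exists K0.
      move=> P Q [K1 A1 P1] [K2 A2 Q2].
      have [/asboolP h|/asboolP h] := totA _ _ A1 A2.
        by exists K2 => // x Kx; split; [apply/P1/h|exact: Q2].
      by exists K1 => // x Kx; split; [exact: P1|apply/Q2/h].
    by move=> P Q PQ [K AK KP]; exists K => //; exact: subset_trans PQ.
  have [U [UU FU]] := ultraFilterLemma FF.
  have [[c0 Cc0] _ _ _] := invC.
  pose x z := if `[< C z >] then z else c0.
  have Cx z : C (x z) by rewrite /x; case: asboolP.
  have bx : fbounded (N \o x).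
    by exists M => z; rewrite /= ger0_norm ?seminorm_ge0//; exact: CM.
  have [w xw] := cN UU bx.
  have memw K : A K -> sval K w.
    move=> AK; have [[[k Kk] Kcl Kcv _] KC] := svalP K.
    (* It agrees with [x] on [sval K], a set of [U], so it has the same weak limit but stays in
       [sval K]. *)
    pose x' z := if `[< sval K z >] then z else k.
    have Kx' z : sval K (x' z) by rewrite /x'; case: asboolP.
    have bx' : fbounded (N \o x').
      by exists M => z; rewrite /= ger0_norm ?seminorm_ge0//; apply/CM/KC.
    apply: (closed_convex_weak_ulim UU Kcl Kcv bx') => // f df; rewrite -(xw f df).
    apply: ulim_eq => // e e0.
    have UK : U (sval K) by apply: FU; exists K.
    apply: filterS (filterI UK (ulim_near UU (fbounded_dual sN df bx) e0)) => z [Kz] /=.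
    by rewrite /x' /x; have -> := asboolT Kz; have -> := asboolT (KC _ Kz).
  have invI : invariant_body T (\bigcap_(K in A) sval K) /\ \bigcap_(K in A) sval K `<=` C.
    split; last by move=> y /(_ _ AK0); have [_ KC] := svalP K0; exact: KC.
    split.
    + by exists w => K AK; exact: memw.
    + move=> y hy K AK; have [[_ Kcl _ _] _] := svalP K.
      by apply: Kcl => e e0; have [z [Iz yz]] := hy e e0; exists z; split => //; exact: Iz.
    + move=> y z t Iy Iz t01 K AK; have [[_ _ Kcv _] _] := svalP K.
      by apply: Kcv => //; [exact: Iy|exact: Iz].
    + by move=> y Iy K AK; have [[_ _ _ KT] _] := svalP K; apply/KT/Iy.
  exists (exist (fun K => invariant_body T K /\ K `<=` C) _ invI) => K AK.
  by apply/asboolP => y; apply.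
exists K; split=> // K' invK' K'K.
have := Kmin (exist _ K' (conj invK' (subset_trans K'K KC))).
by move=> /(_ ltac:(exact/asboolP)) [->].
Qed.

(** Finitely many iterates of y |-> (1 - a) x0 + a T y involve only [T] and convex combinations, so
    Lin's set is preserved. *)
Definition picard (T : V -> V) (a : R) (x0 : V) (k : nat) : V :=
  iter k (fun y => (1 - a) *: x0 + a *: T y) x0.

(** [a] and [k] are uniform in [x0], so the same iteration can be run on all terms of a sequence.
    The error is (1 - a) times a difference of points of [K], plus one step of the iteration, which
    shrinks like a^k. *)
Lemma picard_approx (K : set V) (T : V -> V) c e :
  N_convex K -> (forall x, K x -> K (T x)) -> N_nonexpansive_on N K T ->
  (forall x y, K x -> K y -> N (x - y) <= c) -> 0 < e ->
  exists a k, 0 <= a <= 1 /\ forall x0, K x0 -> N (T (picard T a x0 k) - picard T a x0 k) < e.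
Proof.
move=> Kcv KT Tne Kc e0.
pose c1 := `|c| + 1.
have c10 : 0 < c1 by have := normr_ge0 c; rewrite /c1; lra.
have cc1 : c <= c1 by have := ler_norm c; rewrite /c1; lra.
(* b = 1 - a makes the first part of the error at most e / 4; [k] will make the second less than e /
   2. *)
pose b := Num.min 1 (e / (4 * c1)).
have b0 : 0 < b by rewrite lt_min ltr01 divr_gt0 ?mulr_gt0.
have b1 : b <= 1 by rewrite ge_min lexx.
have be : b * c1 <= e / 4.
  apply: (@le_trans _ _ (e / (4 * c1) * c1)).
    by rewrite ler_wpM2r ?(ltW c10)// ge_min lexx orbT.
  by rewrite le_eqVlt; apply/orP; left; apply/eqP; field; rewrite gt_eqF.
pose a := 1 - b.
have a01 : 0 <= a <= 1 by rewrite /a; apply/andP; split; lra.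
have /andP[a0 a1] := a01.
have ab : 1 - a = b by rewrite /a subKr.
have a_lt1 : a < 1 by rewrite /a; lra.
clearbody a.
have [k ak] : exists k, a ^+ k * c1 < e / 2.
  have h : `|a| < 1 by rewrite ger0_norm.
  have e1 : 0 < e / 2 / c1 by rewrite !divr_gt0.
  have /cvgrPdist_lt/(_ _ e1) := cvg_expr h.
  move=> /filter_ex[k /=]; rewrite sub0r normrN => hk; exists k.
  by rewrite -ltr_pdivlMr//; apply: le_lt_trans hk; exact: ler_norm.
exists a, k; split=> // x0 Kx0.
pose y := picard T a x0.
have yS n : y n.+1 = (1 - a) *: x0 + a *: T (y n) by [].
have Ky n : K (y n).
  elim: n => // n IH; rewrite yS addrC.
  by apply: (Kcv (T (y n)) x0 a) => //; exact: KT.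
have step n : N (y n.+1 - y n) <= a ^+ n * c1.
  elim: n => [|n IH].
    by rewrite expr0 mul1r; apply: le_trans cc1; exact: Kc.
  have -> : y n.+2 - y n.+1 = a *: (T (y n.+1) - T (y n)).
    transitivity ((1 - a) *: x0 + a *: T (y n.+1) - ((1 - a) *: x0 + a *: T (y n))) => //.
    by rewrite opprD addrACA subrr add0r -scalerBr.
  rewrite sN.1 ger0_norm// exprS -mulrA ler_wpM2l//.
  by apply: le_trans IH; apply: Tne.
have -> : T (picard T a x0 k) - picard T a x0 k =
    (T (y k) - y k.+1) + (y k.+1 - y k) by rewrite addrA subrK.
apply: (le_lt_trans (sN.2 _ _)).
have : N (T (y k) - y k.+1) <= b * c1.
  have -> : T (y k) - y k.+1 = b *: (T (y k) - x0).
    rewrite yS ab (_ : a = 1 - b) ?scalerBl ?scale1r; last by rewrite -ab subKr.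
    rewrite scalerBr opprD opprB addrCA [T _ + (_ - _)]addrC subrK addrC//.
  rewrite sN.1 gtr0_norm// ler_pM2l//; apply: le_trans cc1.
  by apply: Kc => //; exact: KT.
have := step k; lra.
Qed.

End MinimalInvariantSets.

(** * The lemmas of Goebel-Karlovitz and Lin *)

Section GoebelKarlovitzLin.
Variables (R : realType) (V : lmodType R) (N : V -> R).
Hypotheses (sN : seminorm N) (cN : weakly_ultracompact N).
Local Open Scope classical_set_scope.
Variables (T : V -> V) (K : set V).
Hypotheses (Kb : N_bounded N K) (Kinv : invariant_body N T K).
Hypothesis Kmin : forall K', invariant_body N T K' -> K' `<=` K -> K `<=` K'.
Hypothesis Tne : N_nonexpansive_on N K T.

Let Kcl : N_closed N K. Proof. by have [] := Kinv. Qed.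
Let Kcv : N_convex K. Proof. by have [] := Kinv. Qed.
Let KT x : K x -> K (T x). Proof. by have [_ _ _ h] := Kinv; exact: h. Qed.

Lemma fbounded_in_body (I : Type) (x : I -> V) : (forall i, K (x i)) -> fbounded (N \o x).
Proof.
move=> Kx; have [M hM] := Kb; exists M => i.
by rewrite ger0_norm /= ?seminorm_ge0//; exact: hM.
Qed.

(** The sublevel set of [g] at [z] is an invariant body, hence all of [K]. *)
Lemma minimal_sublevel (g : V -> R) : convex_fun g -> nonexpansive_fun N g ->
  (forall y, K y -> g (T y) <= g y) -> forall y z, K y -> K z -> g y <= g z.
Proof.
move=> gcv gne gT y z Ky Kz.
have : K `<=` [set u | K u /\ g u <= g z].
  apply: Kmin; last by move=> u [].
  split.
  - by exists z; split.
  - move=> u hu; split.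
      by apply: Kcl => e e0; have [v [[Kv _] uv]] := hu e e0; exists v.
    apply/ler_addgt0Pr => e e0; have [v [[_ gv] uv]] := hu e e0.
    by have := gne u v; lra.
  - move=> u v t [Ku gu] [Kv gv] t01; split; first exact: Kcv.
    by apply: (le_trans (gcv _ _ _ t01)); have /andP[? ?] := t01; nra.
  - by move=> u [Ku gu]; split; [exact: KT|apply: le_trans gu; exact: gT].
by move=> /(_ y Ky) [].
Qed.

(** The centres in [K] of r-balls containing [K] form an invariant body. Its invariance uses
    minimality once more: for such a centre [u], the r-ball around [T u] meets [K] in an invariant
    body. *)
Lemma minimal_radius (w : V) r : K w -> (forall y, K y -> N (w - y) <= r) ->
  forall x y, K x -> K y -> N (x - y) <= r.
Proof.
move=> Kw wr.
have closed_ball z : N_closed N [set y | K y /\ N (z - y) <= r].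
  move=> u hu; split.
    by apply: Kcl => e e0; have [v [[Kv _] uv]] := hu e e0; exists v.
  apply/ler_addgt0Pr => e e0; have [v [[_ zv] uv]] := hu e e0.
  by have := seminorm_tri sN v z u; rewrite (seminormBC sN v u); lra.
have convex_ball z : N_convex [set y | K y /\ N (z - y) <= r].
  move=> u v t [Ku zu] [Kv zv] t01; split; first exact: Kcv.
  rewrite seminormBC//; apply: (le_trans (convex_seminorm sN z _ _ t01)).
  by rewrite (seminormBC sN u) (seminormBC sN v); have /andP[? ?] := t01; nra.
have : K `<=` [set x | K x /\ forall y, K y -> N (x - y) <= r].
  apply: Kmin; last by move=> u [].
  split.
  - by exists w.
  - move=> u hu; split.
      by apply: Kcl => e e0; have [v [[Kv _] uv]] := hu e e0; exists v.
    move=> y Ky; rewrite seminormBC//.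
    apply: (closed_ball y u _).2 => e e0; have [v [[Kv hv] uv]] := hu e e0.
    by exists v; split=> //; split=> //; rewrite seminormBC//; exact: hv.
  - move=> u v t [Ku hu] [Kv hv] t01; split; first exact: Kcv.
    move=> y Ky; rewrite seminormBC//.
    by apply: (convex_ball y u v t _ _ t01).2; split=> //; rewrite seminormBC//;
      [exact: hu|exact: hv].
  - move=> u [Ku hu]; split; first exact: KT.
    have : K `<=` [set y | K y /\ N (T u - y) <= r].
      apply: Kmin; last by move=> ? [].
      split.
      + exists (T u); split; first exact: KT.
        by apply: le_trans (hu u Ku); rewrite !subrr.
      + exact: closed_ball.
      + exact: convex_ball.
      + move=> y [Ky _]; split; first exact: KT.
        by apply: (le_trans (Tne Ku Ky)); exact: hu.
    by move=> h y /h[].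
by move=> h x y /h[_]; apply.
Qed.

Section UltrafilterOnNat.
Variable U : set_system nat.
Hypotheses (UU : UltraFilter U) (Uoo : \oo `<=` U).

Let PU : ProperFilter U := ultra_proper.

Lemma ulim_seminorm_convex (x : nat -> V) : (forall n, K (x n)) ->
  convex_fun (fun y => ulim U (fun n => N (x n - y))) /\
  nonexpansive_fun N (fun y => ulim U (fun n => N (x n - y))).
Proof.
move=> Kx.
have bx y : fbounded (fun n => N (x n - y)).
  apply: (fbounded_seminormB sN (x := x) (y := fun=> y)); first exact: fbounded_in_body.
  exact: fbounded_cst.
split.
  apply: (ulim_convex UU bx) => n y z t t01.
  rewrite seminormBC// (seminormBC sN _ y) (seminormBC sN _ z).
  exact: convex_seminorm.
apply: (ulim_nonexpansive UU bx) => n y z.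
rewrite (seminormBC sN _ y) (seminormBC sN _ z); exact: nonexpansive_seminorm.
Qed.

Lemma ulim_approx_fixed (x y : nat -> V) : (forall n, K (x n)) -> (forall n, K (y n)) ->
  (forall e, 0 < e -> U [set n | N (T (x n) - x n) < e]) ->
  ulim U (fun n => N (T (y n) - x n)) <= ulim U (fun n => N (y n - x n)).
Proof.
move=> Kx Ky xfix; apply/ler_addgt0Pr => e e0.
have b1 : fbounded (fun n => N (y n - x n)).
  by apply: fbounded_seminormB => //; exact: fbounded_in_body.
have b2 : fbounded (fun n => N (T (y n) - x n)).
  apply: (fbounded_seminormB sN (x := T \o y) (y := x)); last exact: fbounded_in_body.
  by apply: fbounded_in_body => n; exact: KT.
have b3 : fbounded (fun n => N (y n - x n) + e).
  have [M hM] := b1; exists (M + `|e|) => n.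
  by apply: (le_trans (ler_normD _ _)); apply: lerD.
rewrite -[X in _ + X](ulim_cst UU) -ulimD//; last exact: fbounded_cst.
apply: ulim_le => //; apply: filterS (xfix e e0) => n /= h.
have := seminorm_tri sN (T (x n)) (T (y n)) (x n).
have := Tne (Ky n) (Kx n); lra.
Qed.

Section Diameter.
Variable c : R.
Hypotheses (Kc : forall x y, K x -> K y -> N (x - y) <= c)
  (cmin : forall r, (forall x y, K x -> K y -> N (x - y) <= r) -> c <= r).

(** Otherwise approximate fixed points stay within c - e of [o]. Their asymptotic distance does not
    increase under [T], so it is at most c - e on all of [K]; their weak limit is then the centre of
    a ball of radius c - e containing [K], and the diameter would be smaller than [c]. *)
Lemma goebel_karlovitz o e : K o -> 0 < e ->
  exists2 d, 0 < d & forall x, K x -> N (T x - x) < d -> c - e < N (x - o).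
Proof.
move=> Ko e0; apply: contrapT => /forall2NP hn.
have ex n : exists x, [/\ K x, N (T x - x) < n.+1%:R^-1 & N (x - o) <= c - e].
  have [|] := hn n.+1%:R^-1; first by rewrite invr_gt0 ltr0Sn.
  move=> /existsNP[x /not_implyP[Kx /not_implyP[hx /negP]]].
  by rewrite -leNgt => hc; exists x.
have [x hx] := choice ex.
have Kx n : K (x n) by have [] := hx n.
have xfix d : 0 < d -> U [set n | N (T (x n) - x n) < d].
  move=> d0; apply: Uoo; apply: filterS (near_infty_natSinv_lt (PosNum d0)) => n /= nd.
  by have [_ h _] := hx n; exact: lt_trans nd.
pose g y := ulim U (fun n => N (x n - y)).
have [gcv gne] := ulim_seminorm_convex Kx.
have gT y : K y -> g (T y) <= g y.
  move=> Ky; have := ulim_approx_fixed Kx (fun=> Ky) xfix.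
  by rewrite /g; under eq_fun do rewrite seminormBC//;
    under [X in _ <= ulim _ X -> _]eq_fun do rewrite seminormBC//.
have bx y : fbounded (fun n => N (x n - y)).
  apply: (fbounded_seminormB sN (x := x) (y := fun=> y)); first exact: fbounded_in_body.
  exact: fbounded_cst.
have go : g o <= c - e.
  by apply: ulim_le_cst => //; apply: ultraT => n /=; have [] := hx n.
have gle y : K y -> g y <= c - e.
  by move=> Ky; apply: le_trans go; exact: (minimal_sublevel gcv gne gT).
have [w xw] := cN UU (fbounded_in_body Kx).
have Kw : K w by apply: (closed_convex_weak_ulim sN UU Kcl Kcv _ xw) => //; exact: fbounded_in_body.
have wr y : K y -> N (w - y) <= c - e.
  move=> Ky; apply: le_trans (gle y Ky).
  apply: (weak_ulim_convex sN UU (fbounded_in_body Kx) xw (g := fun z => N (z - y))).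
    exact: convex_seminorm.
  exact: nonexpansive_seminorm.
by have := cmin (minimal_radius Kw wr); lra.
Qed.

Section Lin.
Variables (x : nat -> V) (o : V).
Hypotheses (Kx : forall n, K (x n)) (Ko : K o).
Hypothesis xfix : forall e, 0 < e -> U [set n | N (T (x n) - x n) < e].
Variable t : R.
Hypothesis t01 : 0 <= t <= 1.

(** Lin's convex invariant set in the ultrapower of [K], with sequences as representatives. *)
Definition lin_set (w : nat -> V) : Prop :=
  [/\ forall n, K (w n), ulim U (fun n => N (w n - x n)) <= (1 - t) * c &
   ulim U (fun n => ulim U (fun m => N (w n - w m))) <= t * c].

Let bK (I : Type) (u v : I -> V) : (forall n, K (u n)) -> (forall n, K (v n)) ->
  fbounded (fun n => N (u n - v n)).
Proof.
move=> Ku Kv; apply: (fboundedP (a := 0) (b := c)) => n.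
by rewrite seminorm_ge0// Kc.
Qed.

Let bKK (u v : nat -> V) : (forall n, K (u n)) -> (forall n, K (v n)) ->
  fbounded (fun n => ulim U (fun m => N (u n - v m))).
Proof.
move=> Ku Kv; apply: (fboundedP (a := 0) (b := c)) => n; apply/andP; split.
  by apply: ulim_ge (bK _ _) _ => //; apply: ultraT => m /=; exact: seminorm_ge0.
by apply: ulim_le_cst (bK _ _) _ => //; apply: ultraT => m /=; exact: Kc.
Qed.

Lemma lin_set_start : lin_set (fun n => (1 - t) *: o + t *: x n).
Proof.
have /andP[t0 t1] := t01; have t1' : 0 <= 1 - t by rewrite subr_ge0.
have Kw n : K ((1 - t) *: o + t *: x n) by rewrite addrC; exact: Kcv.
split=> //.
  apply: ulim_le_cst (bK _ _) _ => //; apply: ultraT => n /=.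
  have -> : (1 - t) *: o + t *: x n - x n = (1 - t) *: (o - x n).
    rewrite scalerBr -addrA; congr (_ + _).
    by rewrite -[X in _ - X]scale1r -scalerBl -scaleNr opprB.
  by rewrite sN.1 ger0_norm// ler_wpM2l// Kc.
apply: ulim_le_cst (bKK _ _) _ => //; apply: ultraT => n /=.
apply: ulim_le_cst (bK _ _) _ => //; apply: ultraT => m /=.
by rewrite opprD addrACA subrr add0r -scalerBr sN.1 ger0_norm// ler_wpM2l// Kc.
Qed.

Lemma lin_set_convex u v a : 0 <= a <= 1 -> lin_set u -> lin_set v ->
  lin_set (fun n => (1 - a) *: u n + a *: v n).
Proof.
move=> a01 [Ku u1 u2] [Kv v1 v2]; have /andP[a0 a1] := a01.
have a1' : 0 <= 1 - a by rewrite subr_ge0.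
have comb (y z y' z' : V) :
    N ((1 - a) *: y + a *: z - ((1 - a) *: y' + a *: z')) <=
    (1 - a) * N (y - y') + a * N (z - z').
  rewrite opprD addrACA -!scalerBr; apply: (le_trans (sN.2 _ _)).
  by rewrite !sN.1 !ger0_norm.
have Kw n : K ((1 - a) *: u n + a *: v n) by rewrite addrC; exact: Kcv.
split=> //.
  apply: (@le_trans _ _ ((1 - a) * ulim U (fun n => N (u n - x n)) +
                         a * ulim U (fun n => N (v n - x n)))); last by nra.
  rewrite -ulim_comb; [|exact: bK|exact: bK].
  apply: (ulim_le UU); [exact: bK|by apply: fbounded_comb; exact: bK|].
  apply: ultraT => n /=; apply: le_trans (comb _ _ _ _).
  by rewrite -scalerDl subrK scale1r.
apply: (@le_trans _ _ ((1 - a) * ulim U (fun n => ulim U (fun m => N (u n - u m))) +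
                       a * ulim U (fun n => ulim U (fun m => N (v n - v m))))); last by nra.
rewrite -ulim_comb; [|exact: bKK|exact: bKK].
apply: (ulim_le UU); [exact: bKK|by apply: fbounded_comb; exact: bKK|].
apply: ultraT => n /=.
rewrite -ulim_comb; [|exact: bK|exact: bK].
apply: (ulim_le UU); [exact: bK|by apply: fbounded_comb; exact: bK|].
by apply: ultraT => m /=.
Qed.

Lemma lin_set_image u : lin_set u -> lin_set (T \o u).
Proof.
move=> [Ku u1 u2]; have KTu n : K ((T \o u) n) by exact: KT.
split=> //.
  by apply: le_trans u1; exact: (ulim_approx_fixed Kx Ku xfix).
apply: le_trans u2; apply: (ulim_le UU); [exact: bKK|exact: bKK|].
apply: ultraT => n /=; apply: (ulim_le UU); [ |exact: bK|].
  by apply: (bK (u := fun=> T (u n)) (v := T \o u)) => // ?; exact: KT.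
by apply: ultraT => m /=; exact: Tne.
Qed.

(** Uniform Picard iteration within Lin's set makes every term so nearly fixed that Goebel-Karlovitz
    applies to it. *)
Lemma lin_lemma e : 0 < e ->
  exists2 w, lin_set w & c - e <= ulim U (fun n => N (w n - o)).
Proof.
move=> e0; have [d d0 hd] := goebel_karlovitz Ko e0.
have [a [k [a01 hk]]] := picard_approx sN Kcv KT Tne Kc d0.
pose w0 n := (1 - t) *: o + t *: x n.
pose w j n := picard T a (w0 n) j.
have lw j : lin_set (w j).
  elim: j => [|j IH]; first exact: lin_set_start.
  exact: (lin_set_convex a01 lin_set_start (lin_set_image IH)).
exists (w k) => //; have [Kw _ _] := lw k; have [Kw0 _ _] := lin_set_start.
apply: ulim_ge => //; first by apply: (bK (v := fun=> o)).
by apply: ultraT => n /=; apply/ltW/hd; [exact: Kw|apply: hk; exact: Kw0].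
Qed.

End Lin.
End Diameter.
End UltrafilterOnNat.
End GoebelKarlovitzLin.

(** * Weak limits in nonsquare spaces *)

Section NonSquareWeakLimit.
Variables (R : realType) (X : normedModType R) (theta : R).
Hypotheses (theta01 : 0 < theta < 1) (ns : nonsquare_by X theta).
Variables (I : Type) (U : set_system I).
Hypothesis UU : UltraFilter U.
Local Open Scope classical_set_scope.

Let PU : ProperFilter U := ultra_proper.
Let nX : X -> R := fun x => `|x|.
Let sX : seminorm nX := norm_seminorm X.

Lemma affine_norm_convex (d : X) b : `|b| <= 1 ->
  convex_fun (fun y : X => `|d + b *: y|) /\ nonexpansive_fun nX (fun y : X => `|d + b *: y|).
Proof.
move=> b1; split=> [y z t t01|y z].
  have /andP[t0 t1] := t01.
  have -> : d + b *: (t *: y + (1 - t) *: z) =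
      t *: (d + b *: y) + (1 - t) *: (d + b *: z).
    rewrite [t *: (d + _)]scalerDr [(1 - t) *: (d + _)]scalerDr addrACA -[X in _ = X + _]scalerDl.
    by rewrite [t + _]addrC subrK scale1r scalerDr !scalerA ![_ * b]mulrC.
  by apply: (le_trans (ler_normD _ _)); rewrite !normrZ !ger0_norm// subr_ge0.
have := ler_normD (d + b *: z) (b *: (y - z)).
rewrite scalerBr addrA addrAC addrK => h.
have : `|b *: y - b *: z| <= nX (y - z) by rewrite -scalerBr normrZ ler_piMl.
lra.
Qed.

Variables (x : I -> X) (w o : X) (M : R).
Hypotheses (xM : forall i, `|x i| <= M) (xw : weak_ulim nX U x w).

Let bx : fbounded (nX \o x).
Proof. by exists M => i; rewrite /nX /= normr_id. Qed.

Let bxB y : fbounded (fun i => `|x i - y|).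
Proof.
apply: (fboundedP (a := 0) (b := M + `|y|)) => i; rewrite normr_ge0/=.
by apply: (le_trans (ler_normB _ _)); rewrite lerD2r.
Qed.

Let bxBC y : fbounded (fun i => `|y - x i|).
Proof. by under eq_fun do rewrite distrC. Qed.

Lemma fbounded_separation : fbounded (fun n => ulim U (fun m => `|x n - x m|)).
Proof.
apply: (fboundedP (a := 0) (b := M + M)) => n; apply/andP; split.
  by apply: ulim_ge => //; apply: ultraT => m /=.
apply: ulim_le_cst => //; apply: ultraT => m /=.
by apply: (le_trans (ler_normB _ _)); apply: lerD.
Qed.

Lemma weak_ulim_separation n : `|x n - w| <= ulim U (fun m => `|x n - x m|).
Proof.
have [cv ne] := affine_norm_convex (x n) (b := -1) ltac:(by rewrite normrN1).
have := weak_ulim_convex sX UU bx xw cv ne.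
rewrite scaleN1r; congr (_ <= _).
by congr ulim; apply/funext => m /=; rewrite scaleN1r.
Qed.

(* If equality almost held, then for small multiples of w - o and of a
   difference x n - x m both the sum and the difference would be long. *)
Lemma nonsquare_weak_ulim p q : p = `|w - o| ->
  q = ulim U (fun n => ulim U (fun m => `|x n - x m|)) ->
  ulim U (fun n => `|x n - o|) <= p + q - 2 * (1 - theta) * Num.min p q.
Proof.
move=> pE qE; set v := ulim U _.
have /andP[t0 t1] := theta01.
have p0 : 0 <= p by rewrite pE normr_ge0.
have q0 : 0 <= q.
  rewrite qE; apply: (ulim_ge UU); [exact: fbounded_separation|].
  by apply: ultraT => n /=; apply: ulim_ge => //; apply: ultraT => m /=.
have vpq : v <= p + q.
  rewrite qE -(ulim_cst UU p) -ulimD//; last 2 first.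
  - exact: fbounded_cst.
  - exact: fbounded_separation.
  apply: ulim_le => //.
    have [K hK] := fbounded_separation; exists (`|p| + K) => n.
    by apply: (le_trans (ler_normD _ _)); rewrite lerD2l.
  apply: ultraT => n /=; have := ler_normD (x n - w) (w - o).
  by rewrite addrA subrK => h; have := weak_ulim_separation n; rewrite -pE in h *; lra.
set mu := Num.min p q.
have mup : mu <= p by rewrite ge_min lexx.
have muq : mu <= q by rewrite ge_min lexx orbT.
have mu0 : 0 <= mu by rewrite le_min p0.
have [->|mune0] := eqVneq mu 0; first by rewrite mulr0 subr0.
have mugt0 : 0 < mu by rewrite lt_neqAle eq_sym mune0.
have pgt0 : 0 < p by lra.
have qgt0 : 0 < q by lra.
(* These factors, at most 1, shrink vectors of lengths [p] and [q] to the common length [mu]. *)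
pose al := mu / p; pose be := mu / q.
have alp : al * p = mu by rewrite /al divfK// gt_eqF.
have beq : be * q = mu by rewrite /be divfK// gt_eqF.
have al0 : 0 <= al by rewrite /al divr_ge0.
have be0 : 0 <= be by rewrite /be divr_ge0.
have al1 : al <= 1 by rewrite /al ler_pdivrMr// mul1r.
have be1 : be <= 1 by rewrite /be ler_pdivrMr// mul1r.
have Nbe1 : `|- be| <= 1 by rewrite normrN ger0_norm.
pose z := w - o; have zE : z = w - o by [].
have zp : `|z| = p by rewrite pE.
clearbody z.
(* [G (x n)] measures the difference of al z and be (x n - x m) for late [m]; convexity of [G]
   bounds its limit over [n] below by [G w]. *)
pose G y := ulim U (fun m => `|al *: z + be *: x m + (- be) *: y|).
have bG y : fbounded (fun m => `|al *: z + be *: x m + (- be) *: y|).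
  apply: (fboundedP (a := 0) (b := `|al *: z| + M + `|y|)) => m; rewrite normr_ge0/=.
  apply: (le_trans (ler_normD _ _)); apply: lerD; last by rewrite normrZ ler_piMl.
  apply: (le_trans (ler_normD _ _)); apply: lerD => //.
  by apply: le_trans (xM m); rewrite normrZ ler_piMl// ger0_norm.
have Gcv : convex_fun G.
  by apply: (ulim_convex UU bG) => m; exact: (affine_norm_convex _ Nbe1).1.
have Gne : nonexpansive_fun nX G.
  by apply: (ulim_nonexpansive UU bG) => m; exact: (affine_norm_convex _ Nbe1).2.
have Gle := weak_ulim_convex sX UU bx xw Gcv Gne.
suff main eta : 0 < eta -> 2 * mu - (p + q - v) <= 2 * theta * mu + 6 * eta.
  suff : 2 * mu - (p + q - v) <= 2 * theta * mu by lra.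
  apply/ler_addgt0Pr => e e0; have e6 : 0 < e / 6 by lra.
  by have := main _ e6; lra.
move=> eta0.
have nearq : U [set n | ulim U (fun m => `|x n - x m|) < q + eta].
  by apply: (ulim_lt_near UU); [exact: fbounded_separation|rewrite -qE; lra].
have nearv : U [set n | v - eta < `|x n - o|].
  by apply: ulim_gt_near => //; rewrite -/v; lra.
(* Removing the fractions 1 - al of [z] and 1 - be of x n - w from x n - o costs at most p + q - 2
   mu + eta in length. *)
have low n : ulim U (fun m => `|x n - x m|) < q + eta -> v - eta < `|x n - o| ->
    2 * mu - (p + q - v) - 2 * eta <= `|al *: z + be *: (x n - w)|.
  move=> hq hv; have hu := le_lt_trans (weak_ulim_separation n) hq.
  have : `|x n - o| <= `|al *: z + be *: (x n - w)| + (1 - al) * p + (1 - be) * `|x n - w|.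
    have -> : x n - o = al *: z + be *: (x n - w) + (1 - al) *: z + (1 - be) *: (x n - w).
      rewrite [X in _ = X + _]addrAC -scalerDl [al + _]addrC subrK scale1r -addrA -scalerDl.
      by rewrite [be + _]addrC subrK scale1r zE addrC addrA subrK.
    apply: (le_trans (ler_normD _ _)); rewrite normrZ [`|1 - be|]ger0_norm ?subr_ge0// lerD2r.
    by apply: (le_trans (ler_normD _ _)); rewrite normrZ [`|1 - al|]ger0_norm ?subr_ge0// zp.
  nra.
have Gw : 2 * mu - (p + q - v) - 2 * eta <= G w.
  apply: ulim_ge => //; apply: filterS (filterI nearq nearv) => n /= [hq hv].
  have -> : al *: z + be *: x n + (- be) *: w = al *: z + be *: (x n - w).
    by rewrite scalerBr addrA scaleNr.
  exact: low.
have bGx : fbounded (G \o x) by exact: (fbounded_nonexpansive sX Gne bx).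
have nearG : U [set n | 2 * mu - (p + q - v) - 3 * eta < G (x n)].
  by apply: (ulim_gt_near UU bGx); lra.
(* The limits are iterated: [n] is fixed first, and [m] is chosen depending on it. *)
have [n /= [[hq hv] hG]] := filter_ex (filterI (filterI nearq nearv) nearG).
have nearm1 : U [set m | `|x n - x m| < q + eta] by exact: ulim_lt_near.
have nearm2 : U [set m | 2 * mu - (p + q - v) - 4 * eta < `|al *: z + be *: x m + (- be) *: x n|].
  by apply: ulim_gt_near => //; rewrite -/(G (x n)); lra.
have nearm3 : U [set m | 2 * mu - (p + q - v) - 4 * eta < `|al *: z + be *: x n + (- be) *: x m|].
  have [cv ne] := affine_norm_convex (al *: z + be *: x n) Nbe1.
  have h := weak_ulim_convex sX UU bx xw cv ne.
  apply: (ulim_gt_near UU (fbounded_nonexpansive sX ne bx)).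
  apply: lt_le_trans h; have := low n hq hv.
  by rewrite scalerBr addrA -scaleNr; lra.
have [m /= [[h1 h2] h3]] := filter_ex (filterI (filterI nearm1 nearm2) nearm3).
have a1 : `|al *: z| <= mu + eta by rewrite normrZ ger0_norm// zp alp; lra.
have a2 : `|be *: (x n - x m)| <= mu + eta.
  rewrite normrZ ger0_norm//; have : be * `|x n - x m| <= be * (q + eta) by rewrite ler_wpM2l// ltW.
  by move=> h; apply: (le_trans h); rewrite mulrDr beq lerD2l ler_piMl// ltW.
have := ns a1 a2; rewrite !normrZ ger0_norm; last by lra.
have -> : al *: z + be *: (x n - x m) = al *: z + be *: x n + (- be) *: x m.
  by rewrite scalerBr addrA scaleNr.
have -> : al *: z - be *: (x n - x m) = al *: z + be *: x m + (- be) *: x n.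
  by rewrite -scalerN opprB scalerBr addrA scaleNr.
have the : theta * eta <= eta by rewrite ler_piMl// ltW.
by move=> [h|h]; lra.
Qed.

End NonSquareWeakLimit.

(** * Absolute norms on the plane *)

Section PsiNorm.
Variables (R : realType) (psi : R -> R -> R).
Hypothesis psiP : absolute_normalized_norm psi.

Let psiZ t a b : psi (t * a) (t * b) = `|t| * psi a b.
Proof. by have [[_ [h _]] _] := psiP. Qed.

Let psiD a b c d : psi (a + c) (b + d) <= psi a b + psi c d.
Proof. by have [[_ [_ h]] _] := psiP. Qed.

Let psi_abs a b : psi a b = psi `|a| `|b|.
Proof. by have [_ [h _]] := psiP. Qed.

Lemma psi_flip : absolute_normalized_norm (fun a b => psi b a).
Proof.
have [[h0 [hZ hD]] [ha [h10 h01]]] := psiP; split; first split.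
- by move=> a b /h0[].
- by split=> [t a b|a b c d]; [exact: hZ|exact: hD].
- by split=> // a b; exact: ha.
Qed.

Lemma psi_l a : psi a 0 = `|a|.
Proof. by have [_ [_ [h _]]] := psiP; rewrite -[a in LHS]mulr1 -[0](mulr0 a) psiZ h mulr1. Qed.

Lemma psi_r b : psi 0 b = `|b|.
Proof. by have [_ [_ [_ h]]] := psiP; rewrite -[b in LHS]mulr1 -[0](mulr0 b) psiZ h mulr1. Qed.

(** Convexity on the segment from (0, b) to (a, b). *)
Lemma psi_convex_l l a b : 0 <= l <= 1 -> psi (l * a) b <= l * psi a b + (1 - l) * `|b|.
Proof.
move=> /andP[l0 l1].
have := psiD (l * a) (l * b) ((1 - l) * 0) ((1 - l) * b).
rewrite !psiZ psi_r mulr0 addr0 -mulrDl [l + _]addrC subrK mul1r.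
by rewrite (ger0_norm l0) [`|1 - l|]ger0_norm ?subr_ge0.
Qed.

Lemma psi_lel a b : `|b| <= psi a b.
Proof.
have := psiD a b (- a) b; rewrite subrr psi_r [psi (- a) b]psi_abs normrN -psi_abs.
by rewrite -mulr2n normrMn mulr2n; lra.
Qed.

Lemma psi_monol a a' b : 0 <= a <= a' -> psi a b <= psi a' b.
Proof.
move=> /andP[a0 aa']; have [a'0|a'0] := eqVneq a' 0.
  by rewrite (_ : a = a')//; lra.
have a'gt0 : 0 < a' by rewrite lt_neqAle eq_sym a'0; lra.
have l01 : 0 <= a / a' <= 1 by rewrite divr_ge0 ?(le_trans a0)// ler_pdivrMr// mul1r.
have := psi_convex_l a' b l01; rewrite divfK// => /le_trans; apply.
by have := psi_lel a' b; have /andP[? ?] := l01; nra.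
Qed.

End PsiNorm.

Section Plane.
Variables (R : realType).

Lemma psi_mono (psi : R -> R -> R) a a' b b' : absolute_normalized_norm psi ->
  0 <= a <= a' -> 0 <= b <= b' -> psi a b <= psi a' b'.
Proof.
move=> psiP haa' hbb'; apply: (le_trans (psi_monol psiP b haa')).
exact: (psi_monol (psi_flip psiP) a' hbb').
Qed.

Lemma psi_ler (psi : R -> R -> R) a b : absolute_normalized_norm psi -> `|a| <= psi a b.
Proof. by move=> psiP; exact: (psi_lel (psi_flip psiP)). Qed.

Lemma psi_le_add (psi : R -> R -> R) a b : absolute_normalized_norm psi ->
  psi a b <= `|a| + `|b|.
Proof.
move=> psiP; have [[_ [_ psiD]] _] := psiP.
by have := psiD a 0 0 b; rewrite addr0 add0r psi_l// psi_r.
Qed.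

Lemma psi_lip (psi : R -> R -> R) a b a' b' : absolute_normalized_norm psi ->
  `|psi a b - psi a' b'| <= `|a - a'| + `|b - b'|.
Proof.
move=> psiP; have [[_ [_ psiD]] _] := psiP.
have := psiD (a - a') (b - b') a' b'; have := psiD (a' - a) (b' - b) a b.
rewrite !subrK; have := psi_le_add (a - a') (b - b') psiP.
have := psi_le_add (a' - a) (b' - b) psiP.
rewrite [`|a' - a|]distrC [`|b' - b|]distrC ler_norml; lra.
Qed.

Lemma min_lip (a b a' b' : R) : `|Num.min a b - Num.min a' b'| <= `|a - a'| + `|b - b'|.
Proof.
have := ler_norm (a - a'); have := ler_norm (b - b').
have := ler_norm (a' - a); have := ler_norm (b' - b).
rewrite [`|a' - a|]distrC [`|b' - b|]distrC ler_norml.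
by have [? |?] := leP a b; have [?|?] := leP a' b'; lra.
Qed.

(* The coordinates, in the limit, of w - o (p), of the separation of a sequence
   in Lin's set with weak limit w (q), of its distances to o (v) and to the
   approximate fixed points (s); xi is the distance of the latter to o. *)
Definition admissible (psi : R -> R -> R) (c t kappa : R) (xi : bool -> R) (e : R)
    (p q v s : bool -> R) : Prop :=
  [/\ forall i, [/\ 0 <= p i, 0 <= q i, 0 <= v i & p i <= s i],
      forall i, v i <= p i + q i - kappa * Num.min (p i) (q i),
      forall i, `|xi i - v i| <= s i,
      psi (p true) (p false) <= (1 - t) * c /\ psi (s true) (s false) <= (1 - t) * c &
      psi (q true) (q false) <= t * c /\ c - e <= psi (v true) (v false)].

(** * Rigidity of admissible data with e = 0 *)

Section Limit.
Variables (psi : R -> R -> R) (c t kappa : R).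
Hypotheses (psiP : absolute_normalized_norm psi) (c0 : 0 < c) (t01 : 0 < t < 1)
  (kappa0 : 0 < kappa).

(** If v true < p true + q true, convexity on a segment with constant second coordinate forces v
    false >= c. As p false <= (1 - t) c and q false <= t c, the kappa term must then vanish, so one
    of these is 0 and the other cannot reach [c]. *)
Lemma admissible_gap xi p q v s : admissible psi c t kappa xi 0 p q v s ->
  v true = p true + q true.
Proof.
move=> [h1 h2 _ [hp _] [hq]]; rewrite subr0 => hv.
have /andP[t0 t1] := t01.
have [p1 q1 v1 _] := h1 true; have [p2 q2 v2 _] := h1 false.
have vle i : v i <= p i + q i.
  have [pi qi _ _] := h1 i; apply: (le_trans (h2 i)).
  have : 0 <= kappa * Num.min (p i) (q i) by rewrite mulr_ge0 ?(ltW kappa0)// le_min pi.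
  lra.
apply/eqP; rewrite eq_le vle/= leNgt; apply/negP => vlt.
have P0 : 0 < p true + q true by lra.
pose l := v true / (p true + q true).
have l0 : 0 <= l by rewrite divr_ge0// ltW.
have l1 : l < 1 by rewrite ltr_pdivrMr// mul1r.
have l01 : 0 <= l <= 1 by rewrite l0 ltW.
have := psi_convex_l psiP (p true + q true) (v false) l01.
rewrite divfK ?gt_eqF// ger0_norm// => hl.
have : psi (p true + q true) (v false) <= c.
  apply: (@le_trans _ _ (psi (p true + q true) (p false + q false))).
    by apply: psi_mono => //; [rewrite lexx ltW|rewrite v2 vle].
  have [[_ [_ psiD]] _] := psiP.
  by apply: (le_trans (psiD _ _ _ _)); lra.
move=> hc; have cv2 : c <= v false by nra.
have pb : p false <= (1 - t) * c.
  by apply: le_trans hp; rewrite -{1}[p false]ger0_norm// psi_lel.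
have qb : q false <= t * c.
  by apply: le_trans hq; rewrite -{1}[q false]ger0_norm// psi_lel.
have tc0 : 0 < t * c by rewrite mulr_gt0.
have tc1 : t * c < c by rewrite gtr_pMl.
have := h2 false; have [pq|pq] := leP (p false) (q false) => h.
  have : 0 <= kappa * p false by rewrite mulr_ge0// ltW.
  have [p00|p0] := eqVneq (p false) 0; first by rewrite p00 mulr0 in h; lra.
  have : 0 < kappa * p false by rewrite mulr_gt0// lt_neqAle eq_sym p0.
  lra.
have : 0 <= kappa * q false by rewrite mulr_ge0// ltW.
have [q00|q0] := eqVneq (q false) 0; first by rewrite q00 mulr0 in h; lra.
have : 0 < kappa * q false by rewrite mulr_gt0// lt_neqAle eq_sym q0.
lra.
Qed.

(** Reaching [c] forces p true = (1 - t) c and q false = t c. Going from (p true, s false) to (p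
    true, q false) must raise psi by t c although the second coordinate moves only by t c - s false;
    so s false = 0 and xi false = v false. *)
Lemma admissible_split xi p q v s : admissible psi c t kappa xi 0 p q v s ->
  v true = p true + q true -> v false = p false + q false ->
  p false = 0 -> q true = 0 -> xi false = t * c.
Proof.
move=> [h1 _ h3 [hp hs] [hq]]; rewrite subr0 => hv.
have /andP[t0 t1] := t01.
have [p1 q1 v1 s1] := h1 true; have [p2 q2 v2 s2] := h1 false.
move=> v1E v2E pf qt; rewrite v1E v2E pf qt addr0 add0r in hv.
have pb : p true <= (1 - t) * c.
  by apply: le_trans hp; rewrite -{1}[p true]ger0_norm// psi_ler.
have qb : q false <= t * c.
  by apply: le_trans hq; rewrite -{1}[q false]ger0_norm// psi_lel.
have := psi_le_add (p true) (q false) psiP; rewrite !ger0_norm// => hpq.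
have pE : p true = (1 - t) * c by lra.
have qE : q false = t * c by lra.
have s20 : 0 <= s false by lra.
have hps : psi (p true) (s false) <= (1 - t) * c.
  by apply: le_trans hs; apply: psi_mono => //; [rewrite p1|rewrite s20 lexx].
have sf0 : s false <= 0.
  have [qs|sq] := leP (q false) (s false).
    have : psi (p true) (q false) <= psi (p true) (s false).
      by apply: psi_mono => //; [rewrite p1 lexx|rewrite q2].
    have : 0 < t * c by rewrite mulr_gt0.
    lra.
  have [[_ [_ psiD]] _] := psiP.
  have := psiD (p true) (s false) 0 (q false - s false).
  rewrite addr0 addrC subrK psi_r// ger0_norm; last by lra.
  lra.
have := h3 false; rewrite v2E pf add0r qE ler_norml; lra.
Qed.

End Limit.

Lemma admissible_flip psi c t kappa xi e p q v s : admissible psi c t kappa xi e p q v s ->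
  admissible (fun a b => psi b a) c t kappa (xi \o negb) e
    (p \o negb) (q \o negb) (v \o negb) (s \o negb).
Proof. by move=> [h1 h2 h3 h4 h5]; split => // i; [exact: h1|exact: h2|exact: h3]. Qed.

(** Equality in both coordinates makes p_i or q_i vanish for each i. If all of [p] or all of [q]
    vanished, psi v would be below [c]; the two crossed cases remain. *)
Lemma admissible_dichotomy psi c t kappa xi p q v s :
  absolute_normalized_norm psi -> 0 < c -> 0 < t < 1 -> 0 < kappa ->
  admissible psi c t kappa xi 0 p q v s -> xi true = t * c \/ xi false = t * c.
Proof.
move=> psiP c0 t01 k0 ad; have adf := admissible_flip ad.
have psiF := psi_flip psiP.
have v1 := admissible_gap psiP c0 t01 k0 ad.
have v2 := admissible_gap psiF c0 t01 k0 adf.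
rewrite /= in v2.
have [h1 h2 _ [hp _] [hq]] := ad; rewrite subr0 => hv.
have /andP[t0 t1] := t01.
have zero i : v i = p i + q i -> p i = 0 \/ q i = 0.
  move=> vi; have [pi qi _ _] := h1 i; have := h2 i; rewrite vi => hi.
  have : kappa * Num.min (p i) (q i) <= 0 by lra.
  rewrite pmulr_rle0// ge_min => /orP[h|h]; [left|right]; lra.
have tc : 0 < t * c by rewrite mulr_gt0.
have tc1 : t * c < c by rewrite gtr_pMl.
have [pt|qt] := zero true v1; have [pf|qf] := zero false v2.
- by move: hv; rewrite v1 v2 pt pf !add0r; lra.
- by left; apply: (admissible_split psiF c0 t01 adf).
- by right; apply: (admissible_split psiP c0 t01 ad).
- by move: hv; rewrite v1 v2 qt qf !addr0; lra.
Qed.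

(** All conditions are closed and the data bounded, so limits along [U] of data with errors 1 / (n +
    1) are admissible with error 0. *)
Lemma admissible_limit (U : set_system nat) psi c t kappa xi :
  UltraFilter U -> (\oo `<=` U)%classic -> absolute_normalized_norm psi ->
  (forall e, 0 < e -> exists p q v s, admissible psi c t kappa xi e p q v s) ->
  0 <= kappa ->
  exists p q v s, admissible psi c t kappa xi 0 p q v s.
Proof.
move=> UU Uoo psiP ex k0.
have exn n : exists P : (bool -> R) * (bool -> R) * (bool -> R) * (bool -> R),
    admissible psi c t kappa xi n.+1%:R^-1 P.1.1.1 P.1.1.2 P.1.2 P.2.
  have [|p [q [v [s h]]]] := ex n.+1%:R^-1; first by rewrite invr_gt0.
  by exists (p, q, v, s).
have [P hP] := choice exn.
pose p i n := (P n).1.1.1 i; pose q i n := (P n).1.1.2 i.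
pose v i n := (P n).1.2 i; pose s i n := (P n).2 i.
have coord (a b : R) (i : bool) r : psi a b <= r -> (if i then a else b) <= r.
  move=> h; apply: le_trans h; case: i.
    by apply: le_trans (psi_ler _ _ psiP); exact: ler_norm.
  by apply: le_trans (psi_lel psiP _ _); exact: ler_norm.
have pn i n : 0 <= p i n <= (1 - t) * c.
  have [h1 _ _ [h _] _] := hP n; have [h0 _ _ _] := h1 i.
  by rewrite h0/=; have := coord _ _ i _ h; case: i {h0}.
have sn i n : 0 <= s i n <= (1 - t) * c.
  have [h1 _ _ [_ h] _] := hP n; have [h0 _ _ h0'] := h1 i.
  by rewrite (le_trans h0 h0')/=; have := coord _ _ i _ h; case: i {h0 h0'}.
have qn i n : 0 <= q i n <= t * c.
  have [h1 _ _ _ [h _]] := hP n; have [_ h0 _ _] := h1 i.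
  by rewrite h0/=; have := coord _ _ i _ h; case: i {h0}.
have vn i n : 0 <= v i n <= (1 - t) * c + t * c.
  have [h1 h2 _ _ _] := hP n; have [h0 h0' h0'' _] := h1 i.
  rewrite h0''/=; apply: (le_trans (h2 i)).
  have /andP[_ pi] := pn i n; have /andP[_ qi] := qn i n.
  have : 0 <= kappa * Num.min (p i n) (q i n) by rewrite mulr_ge0// le_min h0.
  by rewrite -/(p i n) -/(q i n); lra.
have bp i := fboundedP (pn i); have bq i := fboundedP (qn i).
have bv i := fboundedP (vn i); have bs i := fboundedP (sn i).
have bpsi (h h' : nat -> R) : fbounded h -> fbounded h' -> fbounded (fun n => psi (h n) (h' n)).
  move=> [M hM] [M' hM']; apply: (fboundedP (a := 0) (b := M + M')) => n; apply/andP; split.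
    exact: le_trans (psi_ler _ _ psiP).
  by apply: (le_trans (psi_le_add _ _ psiP)); apply: lerD.
have lpsi (h h' : nat -> R) : fbounded h -> fbounded h' ->
    ulim U (fun n => psi (h n) (h' n)) = psi (ulim U h) (ulim U h').
  by move=> bh bh'; apply: ulim_lip2 => // *; exact: psi_lip.
exists (fun i => ulim U (p i)), (fun i => ulim U (q i)), (fun i => ulim U (v i)),
  (fun i => ulim U (s i)).
split=> [i|i|i||].
- split.
  + by apply: ulim_ge => //; apply: ultraT => n /=; have /andP[] := pn i n.
  + by apply: ulim_ge => //; apply: ultraT => n /=; have /andP[] := qn i n.
  + by apply: ulim_ge => //; apply: ultraT => n /=; have /andP[] := vn i n.
  + by apply: ulim_le => //; apply: ultraT => n /=; have [h _ _ _ _] := hP n; have [] := h i.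
- have bmin : fbounded (fun n => Num.min (p i n) (q i n)).
    apply: (fboundedP (a := 0) (b := (1 - t) * c)) => n.
    have /andP[p0 p1] := pn i n; have /andP[q0 q1] := qn i n.
    by rewrite le_min p0 q0 ge_min p1.
  rewrite -(ulim_lip2 UU min_lip (bp i) (bq i)) -ulimD//.
  have bD : fbounded (fun n => p i n + q i n).
    by have := fbounded_comb 1 1 (bp i) (bq i); under eq_fun do rewrite !mul1r.
  rewrite -[ulim U (fun n => p i n + _)]mul1r -mulNr -ulim_comb//.
  apply: ulim_le => //; first exact: fbounded_comb.
  by apply: ultraT => n /=; have [_ h _ _ _] := hP n; rewrite mul1r mulNr; exact: h.
- have hx n : `|xi i - v i n| <= s i n by have [_ _ h _ _] := hP n; exact: h.
  have hD : xi i <= ulim U (fun n => 1 * v i n + 1 * s i n).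
    apply: ulim_ge; first exact: fbounded_comb.
    by apply: ultraT => n /=; have := hx n; rewrite ler_norml; lra.
  have hB : ulim U (fun n => 1 * v i n + -1 * s i n) <= xi i.
    apply: ulim_le_cst; first exact: fbounded_comb.
    by apply: ultraT => n /=; have := hx n; rewrite ler_norml; lra.
  by move: hD hB; rewrite !ulim_comb// ler_norml; lra.
- split; rewrite -lpsi//; apply: ulim_le_cst; [exact: bpsi| |exact: bpsi|];
    by apply: ultraT => n /=; have [_ _ _ [h h'] _] := hP n.
- split; rewrite -lpsi//.
    by apply: ulim_le_cst; [exact: bpsi|apply: ultraT => n /=; have [_ _ _ _ [h h']] := hP n].
  apply/ler_addgt0Pr => e e0; rewrite subr0 -lerBlDr.
  apply: ulim_ge; first exact: bpsi.
  apply: Uoo; apply: filterS (near_infty_natSinv_lt (PosNum e0)) => n /= ne.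
  by have [_ _ _ _ [_ h]] := hP n; apply: le_trans h; rewrite lerD2l lerN2 ltW.
Qed.

End Plane.

(** * Direct sums *)

Section CoordinateFacts.
Variables (R : realType) (X : normedModType R) (theta : R).
Hypotheses (theta01 : 0 < theta < 1) (ns : nonsquare_by X theta).
Variables (U : set_system nat) (x w : nat -> X) (o w0 : X) (M : R).
Hypotheses (UU : UltraFilter U) (xM : forall n, `|x n| <= M) (wM : forall n, `|w n| <= M).
Hypotheses (xo : weak_ulim (fun z : X => `|z|) U x o)
  (ww0 : weak_ulim (fun z : X => `|z|) U w w0).

Lemma fbounded_normB (I : Type) (u v : I -> X) : (forall i, `|u i| <= M) ->
  (forall i, `|v i| <= M) -> fbounded (fun i => `|u i - v i|).
Proof.
move=> uM vM; apply: (fboundedP (a := 0) (b := M + M)) => i; rewrite normr_ge0/=.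
by apply: (le_trans (ler_normB _ _)); apply: lerD.
Qed.

Lemma weak_ulim_coordinate (oM : `|o| <= M) :
  let p := `|w0 - o| in
  let q := ulim U (fun n => ulim U (fun m => `|w n - w m|)) in
  let v := ulim U (fun n => `|w n - o|) in
  let s := ulim U (fun n => `|w n - x n|) in
  let xi := ulim U (fun n => `|x n - o|) in
  [/\ [/\ 0 <= p, 0 <= q, 0 <= v & p <= s],
     v <= p + q - 2 * (1 - theta) * Num.min p q & `|xi - v| <= s].
Proof.
move=> p q v s xi.
have bwx : fbounded (fun n => `|w n - x n|) by exact: fbounded_normB.
have bwo : fbounded (fun n => `|w n - o|) by exact: (fbounded_normB (v := fun=> o)).
have bxo : fbounded (fun n => `|x n - o|) by exact: (fbounded_normB (v := fun=> o)).
have bw : fbounded ((fun z : X => `|z|) \o w).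
  by exists M => n; rewrite /= normr_id.
have bx : fbounded ((fun z : X => `|z|) \o x).
  by exists M => n; rewrite /= normr_id.
split; first split.
- exact: normr_ge0.
- apply: ulim_ge; first exact: (fbounded_separation UU wM).
  apply: ultraT => n /=; apply: ulim_ge; first exact: (fbounded_normB (u := fun=> w n)).
  by apply: ultraT => m /=.
- by apply: ulim_ge => //; apply: ultraT => n /=.
- have sX := norm_seminorm X.
  exact: (weak_ulim_seminorm sX UU (fbounded_seminormB sX bw bx)
    (weak_ulimB sX UU bw bx ww0 xo)).
- exact: (nonsquare_weak_ulim theta01 ns UU wM ww0).
- have h1 : xi <= ulim U (fun n => 1 * `|w n - o| + 1 * `|w n - x n|).
    apply: ulim_le => //; first exact: fbounded_comb.
    apply: ultraT => n /=; rewrite !mul1r.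
    have := ler_normB (w n - o) (w n - x n).
    by rewrite opprB addrC addrA subrK.
  have h2 : v <= ulim U (fun n => 1 * `|x n - o| + 1 * `|w n - x n|).
    apply: ulim_le => //; first exact: fbounded_comb.
    apply: ultraT => n /=; rewrite !mul1r.
    by have := ler_normD (x n - o) (w n - x n); rewrite addrC addrA subrK.
  move: h1 h2; rewrite !ulim_comb// -/v -/s -/xi ler_norml; lra.
Qed.

End CoordinateFacts.

Section PsiSum.
Variables (R : realType) (X1 X2 : normedModType R) (psi : R -> R -> R).
Hypothesis psiP : absolute_normalized_norm psi.

Let N := @psi_sum_norm R X1 X2 psi.

Lemma psi_sum_seminorm : seminorm N.
Proof.
have [[_ [psiZ psiD]] _] := psiP; split=> [a x|x y]; rewrite /N /psi_sum_norm /=.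
  by rewrite !normrZ -[LHS]mul1r -(normr1 R) -psiZ !mul1r psiZ normr_id.
by apply: le_trans (psiD _ _ _ _); apply: psi_mono => //; rewrite normr_ge0/= ler_normD.
Qed.

Lemma psi_sum_ge1 z : `|z.1| <= N z.
Proof. by rewrite -[`|_|]normr_id; exact: psi_ler. Qed.

Lemma psi_sum_ge2 z : `|z.2| <= N z.
Proof. by rewrite -[`|_|]normr_id; exact: psi_lel. Qed.

Lemma psi_sum_eq0 z : N z <= 0 -> z = 0.
Proof.
move=> z0; have := le_trans (psi_sum_ge1 z) z0; have := le_trans (psi_sum_ge2 z) z0.
by rewrite !normr_le0; case: z {z0} => a b /= /eqP-> /eqP->.
Qed.

(** A functional on the sum splits into f (a, 0) + f (0, b), and both parts lie in the dual balls of
    the summands because the norm is normalized. *)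
Lemma psi_sum_weakly_ultracompact :
  weakly_ultracompact (fun x : X1 => `|x|) -> weakly_ultracompact (fun x : X2 => `|x|) ->
  weakly_ultracompact N.
Proof.
move=> c1 c2 I U x UU [M hM].
have b1 : fbounded ((fun z : X1 => `|z|) \o (fun i => (x i).1)).
  exists M => i; rewrite /= normr_id; apply: (le_trans (psi_sum_ge1 _)).
  exact: le_trans (ler_norm _) (hM i).
have b2 : fbounded ((fun z : X2 => `|z|) \o (fun i => (x i).2)).
  exists M => i; rewrite /= normr_id; apply: (le_trans (psi_sum_ge2 _)).
  exact: le_trans (ler_norm _) (hM i).
have [w1 h1] := c1 _ _ _ UU b1; have [w2 h2] := c2 _ _ _ UU b2.
exists (w1, w2) => f [lf fN].
have d1 : dual_ball (fun z : X1 => `|z|) (fun a => f (a, 0)).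
  split=> [a u v|u]; last first.
    by apply: (le_trans (fN _)); rewrite /N /psi_sum_norm /= normr0 psi_l// normr_id.
  by rewrite -lf; congr f; congr pair; rewrite /= scaler0 addr0.
have d2 : dual_ball (fun z : X2 => `|z|) (fun a => f (0, a)).
  split=> [a u v|u]; last first.
    by apply: (le_trans (fN _)); rewrite /N /psi_sum_norm /= normr0 psi_r// normr_id.
  by rewrite -lf; congr f; congr pair; rewrite /= scaler0 addr0.
have fE a b : f (a, b) = f (a, 0) + f (0, b).
  by rewrite -(linear_funD _ _ lf); congr f; congr pair; rewrite /= ?addr0 ?add0r.
rewrite fE -(h1 _ d1) -(h2 _ d2) -ulimD//; last 2 first.
- exact: (fbounded_dual (norm_seminorm X1) d1 b1).
- exact: (fbounded_dual (norm_seminorm X2) d2 b2).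
by congr ulim; apply/funext => i /=; case: (x i) => a b; exact: fE.
Qed.

Lemma weak_ulim_fst (I : Type) (U : set_system I) x w :
  weak_ulim N U x w -> weak_ulim (fun z : X1 => `|z|) U (fun i => (x i).1) w.1.
Proof.
move=> xw f [lf fN]; apply: (xw (fun z => f z.1)); split=> [a u v|u]; first exact: lf.
by apply: (le_trans (fN _)); exact: psi_sum_ge1.
Qed.

Lemma weak_ulim_snd (I : Type) (U : set_system I) x w :
  weak_ulim N U x w -> weak_ulim (fun z : X2 => `|z|) U (fun i => (x i).2) w.2.
Proof.
move=> xw f [lf fN]; apply: (xw (fun z => f z.2)); split=> [a u v|u]; first exact: lf.
by apply: (le_trans (fN _)); exact: psi_sum_ge2.
Qed.

Lemma ulim_psi (I : Type) (U : set_system I) (h1 h2 : I -> R) : UltraFilter U ->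
  fbounded h1 -> fbounded h2 ->
  ulim U (fun i => psi (h1 i) (h2 i)) = psi (ulim U h1) (ulim U h2).
Proof. by move=> UU b1 b2; apply: ulim_lip2 => // *; exact: psi_lip. Qed.

Variable theta : R.
Hypotheses (theta01 : 0 < theta < 1) (ns1 : nonsquare_by X1 theta) (ns2 : nonsquare_by X2 theta).
Hypothesis cN : weakly_ultracompact N.

Section Admissible.
Local Open Scope classical_set_scope.
Variables (T : X1 * X2 -> X1 * X2) (K : set (X1 * X2)).
Hypotheses (Kb : N_bounded N K) (Kinv : invariant_body N T K).
Hypothesis Kmin : forall K', invariant_body N T K' -> K' `<=` K -> K `<=` K'.
Hypothesis Tne : N_nonexpansive_on N K T.
Variable U : set_system nat.
Hypotheses (UU : UltraFilter U) (Uoo : \oo `<=` U).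
Variable c : R.
Hypotheses (Kc : forall x y, K x -> K y -> N (x - y) <= c)
  (cmin : forall r, (forall x y, K x -> K y -> N (x - y) <= r) -> c <= r).
Variables (x : nat -> X1 * X2) (o : X1 * X2).
Hypotheses (Kx : forall n, K (x n)) (Ko : K o) (xo : weak_ulim N U x o).
Hypothesis xfix : forall e, 0 < e -> U [set n | N (T (x n) - x n) < e].

(** psi commutes with limits of bounded coordinates, which turns Lin's estimates for [N] into
    estimates in the plane. The function in the place of xi involves only [x] and [o], so it is the
    same for all [t] and [e]. *)
Lemma lin_admissible t e : 0 <= t <= 1 -> 0 < e -> exists p q v s,
  admissible psi c t (2 * (1 - theta))
    (fun i => if i then ulim U (fun n => `|(x n).1 - o.1|) else ulim U (fun n => `|(x n).2 - o.2|))
    e p q v s.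
Proof.
move=> t01 e0.
have [w [Kw ws wq] wv] := lin_lemma psi_sum_seminorm cN Kb Kinv Kmin Tne UU Uoo Kc cmin
  Kx Ko xfix t01 e0.
have [w0 ww0] := cN UU (fbounded_in_body psi_sum_seminorm Kb Kw).
have [M hM] := Kb.
have M1 z : K z -> `|z.1| <= M by move=> Kz; apply: le_trans (psi_sum_ge1 z) (hM z Kz).
have M2 z : K z -> `|z.2| <= M by move=> Kz; apply: le_trans (psi_sum_ge2 z) (hM z Kz).
have [a1 a2 a3] := weak_ulim_coordinate theta01 ns1 UU (fun n => M1 _ (Kx n)) (fun n => M1 _ (Kw n))
  (weak_ulim_fst xo) (weak_ulim_fst ww0) (M1 _ Ko).
have [b1 b2 b3] := weak_ulim_coordinate theta01 ns2 UU (fun n => M2 _ (Kx n)) (fun n => M2 _ (Kw n))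
  (weak_ulim_snd xo) (weak_ulim_snd ww0) (M2 _ Ko).
have B1 (J : Type) (u v : J -> X1 * X2) : (forall i, K (u i)) -> (forall i, K (v i)) ->
    fbounded (fun i => `|(u i).1 - (v i).1|).
  by move=> Ku Kv; apply: (fbounded_normB (M := M)) => i; exact: M1.
have B2 (J : Type) (u v : J -> X1 * X2) : (forall i, K (u i)) -> (forall i, K (v i)) ->
    fbounded (fun i => `|(u i).2 - (v i).2|).
  by move=> Ku Kv; apply: (fbounded_normB (M := M)) => i; exact: M2.
exists (fun i => if i then `|w0.1 - o.1| else `|w0.2 - o.2|),
  (fun i => if i then ulim U (fun n => ulim U (fun m => `|(w n).1 - (w m).1|))
            else ulim U (fun n => ulim U (fun m => `|(w n).2 - (w m).2|))),
  (fun i => if i then ulim U (fun n => `|(w n).1 - o.1|) else ulim U (fun n => `|(w n).2 - o.2|)),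
  (fun i => if i then ulim U (fun n => `|(w n).1 - (x n).1|)
            else ulim U (fun n => `|(w n).2 - (x n).2|)).
split; [by case|by case|by case|split|split].
- apply: le_trans ws.
  have sN := psi_sum_seminorm.
  have bw := fbounded_in_body sN Kb Kw; have bx := fbounded_in_body sN Kb Kx.
  exact: (weak_ulim_seminorm sN UU (fbounded_seminormB sN bw bx)
    (weak_ulimB sN UU bw bx ww0 xo)).
- by rewrite -ulim_psi//; [exact: B1|exact: B2].
- rewrite -ulim_psi//; last 2 first.
  + exact: (fbounded_separation UU (fun n => M1 _ (Kw n))).
  + exact: (fbounded_separation UU (fun n => M2 _ (Kw n))).
  rewrite (_ : (fun n => psi _ _) = fun n => ulim U (fun m => N (w n - w m)))//.
  apply/funext => n; rewrite -ulim_psi//.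
    exact: (B1 _ (fun=> w n) w).
  exact: (B2 _ (fun=> w n) w).
- rewrite -ulim_psi//; first exact: (B1 _ w (fun=> o)).
  exact: (B2 _ w (fun=> o)).
Qed.

Lemma minimal_body_diameter : c <= 0.
Proof.
rewrite leNgt; apply/negP => c0.
have kappa0 : 0 < 2 * (1 - theta) by move: theta01; lra.
set xi := (fun i : bool => if i then ulim U (fun n => `|(x n).1 - o.1|)
  else ulim U (fun n => `|(x n).2 - o.2|)).
have key t : 0 < t < 1 -> xi true = t * c \/ xi false = t * c.
  move=> t01; have t01' : 0 <= t <= 1 by lra.
  have [p [q [v [s ad]]]] := admissible_limit UU Uoo psiP
    (fun e e0 => lin_admissible t01' e0) (ltW kappa0).
  exact: (admissible_dichotomy psiP c0 t01 kappa0 ad).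
(* Three values of [t] for two coordinates: one coordinate would equal t c for two distinct [t],
   although c > 0. *)
by case: (key (1 / 4) ltac:(lra)) => ?; case: (key (1 / 2) ltac:(lra)) => ?;
  case: (key (3 / 4) ltac:(lra)) => ?; lra.
Qed.

End Admissible.

Lemma psi_sum_fixed_point_property : fixed_point_property N.
Proof.
move=> C C0 Cb Ccl Ccv T CT Tne.
have sN := psi_sum_seminorm.
have invC : invariant_body N T C by split.
have [K [KC invK Kmin]] := exists_minimal_invariant_body sN cN Cb invC.
have Kb : N_bounded N K by have [M hM] := Cb; exists M => x /KC; exact: hM.
have KTne : N_nonexpansive_on N K T by move=> x y /KC Cx /KC Cy; exact: Tne.
have [[x0 Kx0] Kcl Kcv KT] := invK.
have [M hM] := Kb.
pose E := [set r | exists x y, [/\ K x, K y & r = N (x - y)]]%classic.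
have Eub : has_ubound E.
  exists (M + M) => _ [x [y [Kx Ky ->]]].
  by apply: (le_trans (seminormB sN _ _)); apply: lerD; exact: hM.
pose c := sup E.
have Kc x y : K x -> K y -> N (x - y) <= c.
  by move=> Kx Ky; apply: ub_le_sup => //; exists x, y.
have cmin r : (forall x y, K x -> K y -> N (x - y) <= r) -> c <= r.
  move=> h; apply: ge_sup; first by exists (N (x0 - x0)), x0, x0.
  by move=> _ [x [y [Kx Ky ->]]]; exact: h.
have [U [UU Uoo]] := ultraFilterLemma eventually_filter.
have exn n : exists y, K y /\ N (T y - y) < n.+1%:R^-1.
  have n0 : 0 < n.+1%:R^-1 :> R by rewrite invr_gt0.
  have [a [k [a01 hk]]] := picard_approx sN Kcv KT KTne Kc n0.
  exists (picard T a x0 k); split; last exact: hk.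
  elim: k {hk} => // k IH; rewrite /picard iterS addrC; apply: (Kcv _ _ a) => //.
  exact: KT.
have [x hx] := choice exn.
have Kx n : K (x n) by have [] := hx n.
have [y xy] := cN UU (fbounded_in_body sN Kb Kx).
have Ky : K y.
  by apply: (closed_convex_weak_ulim sN UU Kcl Kcv _ xy) => //;
    exact: (fbounded_in_body sN Kb Kx).
have xfix e : 0 < e -> U [set n | N (T (x n) - x n) < e]%classic.
  move=> e0; apply: Uoo; apply: filterS (near_infty_natSinv_lt (PosNum e0)) => n /= ne.
  by have [_ h] := hx n; exact: lt_trans ne.
have cle0 := minimal_body_diameter Kb invK Kmin KTne UU Uoo Kc cmin Kx Ky xy xfix.
(* The diameter of [K] is at most 0, so [T x0] and [x0], both in [K], coincide. *)
exists x0; split; first exact: KC.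
apply/eqP; rewrite -subr_eq0; apply/eqP/psi_sum_eq0; apply: le_trans cle0.
by apply: Kc => //; exact: KT.
Qed.

End PsiSum.

Theorem theorem3p7 (R : realType) (X1 X2 : completeNormedModType R)
  (psi : R -> R -> R) :
  uniformly_nonsquare X1 -> uniformly_nonsquare X2 ->
  absolute_normalized_norm psi ->
  fixed_point_property (@psi_sum_norm R X1 X2 psi).
Proof.
move=> ns1 ns2 psiP.
have [t1 /andP[t10 t11] h1] := uniformly_nonsquareP ns1.
have [t2 /andP[t20 t21] h2] := uniformly_nonsquareP ns2.
pose theta := Num.max t1 t2.
have theta01 : 0 < theta < 1 by rewrite lt_max t10 gt_max t11 t21.
apply: (psi_sum_fixed_point_property psiP theta01).
- apply: nonsquare_byW h1 _; by rewrite le_max lexx.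
- apply: nonsquare_byW h2 _; by rewrite le_max lexx orbT.
apply: (psi_sum_weakly_ultracompact psiP).
  by apply: nonsquare_weakly_ultracompact ns1 => F FF; exact: cauchy_cvg.
by apply: nonsquare_weakly_ultracompact ns2 => F FF; exact: cauchy_cvg.
Qed.
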